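(* Let $\psi\colon\mathbb{G}\to\mathbb{C}$ be the linear function defined on a graph $G$ with vertex set $V$ by $$\psi(G)=2^{-|V|}\sum_{V'\subseteq V}(-1)^{|V'|}\,3^{\eta(G_{V'})},$$ where $G_{V'}$ is the framed graph obtained from $G$ by assigning framing $1$ to the vertices in $V'$ and framing $0$ to the vertices in $V\setminus V'$. Then $\psi$ is a 4-invariant extending $w_{\mathfrak{sl}(2)}$ at $c=1$; that is, $\psi$ is a 4-invariant and $\psi(\Gamma_D)=w_{\mathfrak{sl}(2)}(D)|_{c=1}$ for every chord diagram $D$.
   Context: Chord diagrams. A chord diagram of order $n\ge 0$ is a set of $2n$ pairwise distinct points on an oriented circle together with a complete pairing of these points (the pairs are called chords), considered up to orientation-preserving diffeomorphism of the circle. $\mathbb{A}$ is the complex vector space freely spanned by all chord diagrams. Two chords intersect if their endpoints interlace on the circle. The intersection graph $\Gamma_D$ of a chord diagram $D$ has the chords of $D$ as vertices, two vertices being adjacent iff the chords intersect. The $\mathfrak{sl}(2)$-weight system $w_{\mathfrak{sl}(2)}\colon\mathbb{A}\to\mathbb{C}[c]$ is the weight system associated with the Lie algebra $\mathfrak{sl}(2)$ with its Killing form, $c$ being the Casimir element. It is well defined and uniquely determined (Chmutov–Varchenko) by: its value on the diagram with no chords is $1$, and for every chord diagram $D$ and every chord $a$ of $D$ intersecting exactly $k$ other chords $a_1,\dots,a_k$, $$w_{\mathfrak{sl}(2)}(D)=\Bigl(c-\frac k2\Bigr)w_{\mathfrak{sl}(2)}(D_a)+\frac12\sum_{1\le i<j\le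 k}\bigl(w_{\mathfrak{sl}(2)}(D''_{i,j})-w_{\mathfrak{sl}(2)}(D^{\times}_{i,j})\bigr).$$ Here $D_a$ is $D$ with $a$ deleted. The endpoints of $a$ split the circle into two open arcs, and each $a_i$ has one endpoint $p_i$ on the first arc and one endpoint $p_i^*$ on the second; $D''_{i,j}$ (resp. $D^\times_{i,j}$) is obtained from $D$ by deleting $a$ and replacing $a_i,a_j$ by the chords $\{p_i,p_j\},\{p_i^*,p_j^*\}$ (resp. $\{p_i,p_j^*\},\{p_i^*,p_j\}$). Graphs. All graphs are finite and simple, considered up to isomorphism; $\mathbb{G}$ is the complex vector space freely spanned by isomorphism classes of graphs. A framed graph is a graph together with a function (framing) from its vertex set to $\mathbb{Z}/2\mathbb{Z}$. The adjacency matrix over $\mathbb{Z}/2\mathbb{Z}$ of a framed graph has the usual off-diagonal adjacency entries, and its diagonal entries are the framings of the corresponding vertices. $\eta$ denotes the corank (dimension of the kernel) of this matrix over $\mathbb{Z}/2\mathbb{Z}$; it is $0$ for the empty graph. A linear map $g\colon\mathbb{G}\to M$ to a complex vector space is a 4-invariant if for every graph $G$ and every ordered pair $(a,b)$ of adjacent vertices of $G$, $$g(G)-g(G'_{ab})=g(\widetilde G_{ab})-g(\widetilde G'_{ab}),$$ where $G'_{ab}$ is $G$ with the edge $ab$ removed; $\widetilde G_{ab}$ is obtained from $G$ by switching the adjacency of $a$ with every vertex $v\ne a,b$ that is adjacent to $b$, everything else (including the edge $ab$) being kept; and $\widetilde G'_{ab}$ is $\widetilde G_{ab}$ with the edge $ab$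 removed. *)

(* Defs.v *)
From HB Require Import structures.
From mathcomp Require Import all_boot all_order all_algebra.
From mathcomp Require Import generic_quotient reals complex freeg.

Set Implicit Arguments.
Unset Strict Implicit.
Unset Printing Implicit Defensive.

Import GRing.Theory.
Local Open Scope ring_scope.
Local Open Scope quotient_scope.

Definition simple_adj n (A : 'M[bool]_n) : bool :=
  [forall i, ~~ A i i] && [forall i, forall j, A i j == A j i].

Record sgraph n := SGraph { adj :> 'M[bool]_n; adj_simple : simple_adj adj }.

HB.instance Definition _ n := [isSub for @adj n].
HB.instance Definition _ n := [Choice of sgraph n by <:].

Definition graph := {n : nat & sgraph n}.

Lemma sgraph_irr n (G : sgraph n) : irreflexive G.
Proof. by case/andP: (adj_simple G) => /forallP h _ i; apply/negbTE. Qed.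

Lemma sgraph_sym n (G : sgraph n) : symmetric G.
Proof.
by case/andP: (adj_simple G) => _ /forallP h i j; apply/eqP; move/forallP: (h i).
Qed.

Lemma simple_adj_of n (e : rel 'I_n) :
  irreflexive e -> symmetric e -> simple_adj (\matrix_(i, j) e i j).
Proof.
move=> irr sym; apply/andP; split; apply/forallP=> i; first by rewrite mxE irr.
by apply/forallP=> j; rewrite !mxE sym.
Qed.

Definition giso (G H : graph) : bool :=
  (tag G == tag H) &&
  [exists f : {ffun 'I_(tag G) -> 'I_(tag H)},
     injectiveb f &&
     [forall i, forall j, tagged G i j == tagged H (f i) (f j)]].

Lemma gisoP (G H : graph) :
  reflect (tag G = tag H /\ exists2 f : 'I_(tag G) -> 'I_(tag H), injective f
             & forall i j, tagged G i j = tagged H (f i) (f j))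
          (giso G H).
Proof.
apply: (iffP andP) => -[].
  move=> /eqP e /existsP[f /andP[/injectiveP fi /forallP fh]]; split=> //.
  by exists f => // i j; apply/eqP; move/forallP: (fh i).
move=> e [f fi fh]; split; first exact/eqP.
apply/existsP; exists [ffun x => f x]; apply/andP; split.
  by apply/injectiveP=> x y; rewrite !ffunE => /fi.
by apply/forallP=> i; apply/forallP=> j; rewrite !ffunE fh.
Qed.

Lemma giso_refl : reflexive giso.
Proof. by move=> G; apply/gisoP; split=> //; exists id. Qed.

Lemma giso_sym : symmetric giso.
Proof.
suff h G H : giso G H -> giso H G by move=> G H; apply/idP/idP; apply: h.
case/gisoP=> e [f fi fh]; apply/gisoP; split=> //.
have [g gK fK] : bijective f by apply: inj_card_bij; rewrite ?card_ord ?e.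
by exists g => [|i j]; [apply: can_inj fK | rewrite fh !fK].
Qed.

Lemma giso_trans : transitive giso.
Proof.
move=> H G K /gisoP[e [f fi fh]] /gisoP[e' [g gi gh]]; apply/gisoP.
split; first by rewrite e.
by exists (g \o f) => [|i j]; [apply: inj_comp | rewrite fh gh].
Qed.

Canonical giso_equiv := EquivRel giso giso_refl giso_sym giso_trans.

Definition graph_class := {eq_quot giso}.

Definition gclass n (G : sgraph n) : graph_class :=
  \pi_graph_class (Tagged sgraph G).

Definition GSpace (R : realType) := {freeg graph_class / R[i]}.

Definition gvec (R : realType) n (G : sgraph n) : GSpace R := << gclass G >>.

Section GraphMoves.
Variables (n : nat) (G : sgraph n) (a b : 'I_n).

Definition del_edge_rel : rel 'I_n := fun x y =>
  G x y && ~~ (((x == a) && (y == b)) || ((x == b) && (y == a))).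

Fact del_edge_subproof : simple_adj (\matrix_(x, y) del_edge_rel x y).
Proof.
apply: simple_adj_of => [x|x y]; rewrite /del_edge_rel.
  by rewrite sgraph_irr.
rewrite sgraph_sym; congr (_ && ~~ _).
by rewrite orbC andbC [(y == b) && _]andbC.
Qed.

Definition del_edge : sgraph n := SGraph del_edge_subproof.

Definition switch_rel : rel 'I_n := fun x y =>
  G x y (+) [|| [&& x == a, y != a, y != b & G b y]
              | [&& y == a, x != a, x != b & G b x]].

Fact switch_subproof : simple_adj (\matrix_(x, y) switch_rel x y).
Proof.
apply: simple_adj_of => [x|x y]; rewrite /switch_rel.
  by rewrite sgraph_irr; case: (x == a).
by rewrite sgraph_sym orbC.
Qed.

Definition switch : sgraph n := SGraph switch_subproof.

End GraphMoves.

Definition four_invariant (R : realType) (M : lmodType R[i])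
    (g : {linear GSpace R -> M}) : Prop :=
  forall n (G : sgraph n) (a b : 'I_n), G a b ->
    g (gvec R G) - g (gvec R (del_edge G a b))
    = g (gvec R (switch G a b)) - g (gvec R (del_edge (switch G a b) a b)).

Definition framed_adj n (G : sgraph n) (f : 'I_n -> 'F_2) : 'M['F_2]_n :=
  \matrix_(i, j) if i == j then f i else (G i j)%:R.

Definition corank n (A : 'M['F_2]_n) : nat := \rank (kermx A).

Definition set_framing n (V' : {set 'I_n}) : 'I_n -> 'F_2 :=
  fun i => (i \in V')%:R.

(* A chord diagram is encoded by the cyclic word read off along the oriented
   circle, starting at an arbitrary point: positions of the word are the
   points, and two positions carry the same letter iff they are the ends of
   one chord, so that every letter occurs exactly twice.  Two words give the
   same chord diagram iff they agree up to a rotation and an injective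
   renaming of the letters (cd_equiv). *)

Definition double_occ (s : seq nat) : bool :=
  all (fun x => count_mem x s == 2) s.

Record chord_diagram :=
  ChordDiagram { cd_word :> seq nat; cd_wordP : double_occ cd_word }.

HB.instance Definition _ := [isSub for cd_word].
HB.instance Definition _ := [Choice of chord_diagram by <:].

Definition pattern (s : seq nat) : seq nat := [seq index x s | x <- s].

Definition cd_equiv (D E : chord_diagram) : bool :=
  has (fun r => pattern (rot r D) == pattern E) (iota 0 (size D).+1).

Lemma pattern_map (f : nat -> nat) (s : seq nat) :
  {in s &, injective f} -> pattern (map f s) = pattern s.
Proof.
move=> fi; rewrite /pattern -map_comp; apply/eq_in_map => x xs /=.
suff h t : {subset t <= s} -> index (f x) (map f t) = index x t by apply: h.
elim: t => //= y t IH ht; rewrite IH => [|z zt]; last by rewrite ht ?inE ?zt ?orbT.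
by have ys := ht y (mem_head y t); rewrite (inj_in_eq fi).
Qed.

Lemma patternE s t : pattern s = pattern t ->
  exists2 f : nat -> nat, {in s &, injective f} & t = map f s.
Proof.
move=> e; have es : size s = size t by have := congr1 size e; rewrite !size_map.
pose f x := nth 0%N t (index x s); have ft : t = map f s.
  apply: (@eq_from_nth _ 0%N) => [|i it]; first by rewrite size_map.
  rewrite (nth_map 0%N) ?es // /f.
  have -> : index (nth 0%N s i) s = index (nth 0%N t i) t.
    have := congr1 (nth 0%N ^~ i) e.
    by rewrite /pattern !(nth_map 0%N) ?es.
  by rewrite nth_index // mem_nth.
exists f => // x y xs ys; rewrite /f => exy.
have key z : z \in s -> index (nth 0%N t (index z s)) t = index z s.
  move=> zs; have iz : (index z s < size s)%N by rewrite index_mem.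
  have := congr1 (nth 0%N ^~ (index z s)) e.
  by rewrite /pattern !(nth_map 0%N) -?es // nth_index.
by rewrite -(nth_index 0%N xs) -(key x xs) exy key // nth_index.
Qed.

Lemma pattern_rot s t r :
  pattern s = pattern t -> pattern (rot r s) = pattern (rot r t).
Proof.
case/patternE=> f fi ->; rewrite -map_rot pattern_map //.
by move=> x y; rewrite !mem_rot; apply: fi.
Qed.

Lemma cd_equivP (D E : chord_diagram) :
  reflect (exists r, pattern (rot r D) = pattern E) (cd_equiv D E).
Proof.
apply: (iffP hasP) => [[r _ /eqP e]|[r e]]; first by exists r.
have [rD|Dr] := leqP r (size D).
  by exists r; [rewrite mem_iota | apply/eqP].
exists 0%N; first by rewrite mem_iota.
by rewrite rot0 -e rot_oversize ?(ltnW Dr).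
Qed.

Lemma cd_equiv_refl : reflexive cd_equiv.
Proof. by move=> D; apply/cd_equivP; exists 0%N; rewrite rot0. Qed.

Lemma cd_equiv_sym : symmetric cd_equiv.
Proof.
suff h D E : cd_equiv D E -> cd_equiv E D by move=> D E; apply/idP/idP; apply: h.
case/cd_equivP=> r e; apply/cd_equivP; exists (size (rot r D) - r)%N.
by rewrite -(pattern_rot _ e) -/(rotr r _) rotK.
Qed.

Lemma cd_equiv_trans : transitive cd_equiv.
Proof.
move=> E D F /cd_equivP[r e] /cd_equivP[r' e']; apply/cd_equivP.
have [k ek] : exists k, rot r' (rot r D) = rot k D.
  have [le|lt] := leqP r (size D); last first.
    by exists r'; rewrite [rot r D]rot_oversize // ltnW.
  have [le'|lt'] := leqP r' (size D); last first.
    by exists r; rewrite [LHS]rot_oversize ?size_rot // ltnW.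
  by rewrite rot_add_mod //; eexists.
by exists k; rewrite -ek (pattern_rot _ e).
Qed.

Canonical cd_equiv_rel :=
  EquivRel cd_equiv cd_equiv_refl cd_equiv_sym cd_equiv_trans.

Definition cd_class := {eq_quot cd_equiv}.

Definition ASpace (R : realType) := {freeg cd_class / R[i]}.

Definition dvec (R : realType) (D : chord_diagram) : ASpace R :=
  << \pi_cd_class D >>.

Definition empty_cd : chord_diagram := @ChordDiagram [::] isT.

Definition chords (D : chord_diagram) : seq nat := undup D.

Definition intersect (D : chord_diagram) (a b : nat) : bool :=
  (a != b) && (let s := [seq x <- cd_word D | (x == a) || (x == b)] in
               (s == [:: a; b; a; b]) || (s == [:: b; a; b; a])).

Lemma intersect_irr D : irreflexive (intersect D).
Proof. by move=> a; rewrite /intersect eqxx. Qed.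

Lemma intersect_sym D : symmetric (intersect D).
Proof.
move=> a b; rewrite /intersect eq_sym orbC; congr (_ && _).
by rewrite (eq_filter (a2 := fun x => (x == b) || (x == a))) // => x; rewrite orbC.
Qed.

Section IntersectionGraph.
Variable D : chord_diagram.

Let e : rel 'I_(size (chords D)) :=
  fun i j => intersect D (nth 0%N (chords D) i) (nth 0%N (chords D) j).

Fact intersection_subproof : simple_adj (\matrix_(i, j) e i j).
Proof. by apply: simple_adj_of => [i|i j]; rewrite /e ?intersect_irr 1?intersect_sym. Qed.

Definition intersection_graph : sgraph (size (chords D)) :=
  SGraph intersection_subproof.

End IntersectionGraph.

Section Surgery.
Variable D : chord_diagram.

Fact del_chord_subproof a : double_occ [seq x <- cd_word D | x != a].
Proof.
apply/allP=> x; rewrite mem_filter => /andP[xa xD].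
rewrite count_filter (@eq_count _ _ (pred1 x)) ?(allP (cd_wordP D)) //.
by move=> y /=; case: eqP => // ->.
Qed.

Definition del_chord a : chord_diagram := ChordDiagram (del_chord_subproof a).

Let count_rot_cd (p : pred nat) n : count p (rot n D) = count p D.
Proof. by apply/permP; rewrite perm_rot. Qed.

(* The two open arcs cut out by chord a, both read along the orientation of
   the circle; the first one follows the first end of a in the word. *)
Definition arcs (a : nat) : seq nat * seq nat :=
  let s := behead (rot (index a D) D) in
  (take (index a s) s, drop (index a s).+1 s).

Lemma arcsP a : a \in cd_word D ->
  rot (index a D) D = a :: (arcs a).1 ++ a :: (arcs a).2.
Proof.
move=> aD; rewrite /arcs rot_index //=; set s := _ ++ _.
have aS : a \in s.
  have := allP (cd_wordP D) _ aD.
  rewrite /= -(count_rot_cd _ (index a D)) rot_index //= eqxx -/s.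
  by rewrite eqSS => /eqP c1; rewrite -has_pred1 has_count c1.
by rewrite -{1}(cat_take_drop (index a s) s) (drop_nth 0%N) ?index_mem // nth_index.
Qed.

Lemma arcs_count a x : a \in cd_word D -> x \in cd_word D -> x != a ->
  (count_mem x (arcs a).1 + count_mem x (arcs a).2)%N = 2.
Proof.
move=> aD xD xa; have /eqP := allP (cd_wordP D) _ xD.
rewrite -(count_rot_cd _ (index a D)) arcsP //= count_cat /=.
by rewrite eq_sym (negbTE xa) !add0n.
Qed.

(* Words of D'' and D^x, with p_i, p_j the points labelled i, j on the first
   arc and p_i^*, p_j^* those on the second one.  The letters are reassigned:
   in D'' the chord {p_i, p_j} receives the letter i and {p_i^*, p_j^*} the
   letter j; in D^x the letters i and j are exchanged on the second arc. *)
Definition par_word (a i j : nat) : seq nat :=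
  [seq (if x == j then i else x) | x <- (arcs a).1] ++
  [seq (if x == i then j else x) | x <- (arcs a).2].

Definition cross_word (a i j : nat) : seq nat :=
  (arcs a).1 ++
  [seq (if x == i then j else if x == j then i else x) | x <- (arcs a).2].

(* The default value D of insubd is only used outside of the intended
   domain: see par_cdE and cross_cdE. *)
Definition par_cd (a i j : nat) : chord_diagram := insubd D (par_word a i j).
Definition cross_cd (a i j : nat) : chord_diagram := insubd D (cross_word a i j).

Lemma arcs_notin a : a \in cd_word D ->
  (a \notin (arcs a).1) && (a \notin (arcs a).2).
Proof.
move=> aD; have := allP (cd_wordP D) _ aD.
rewrite -(count_rot_cd _ (index a D)) arcsP //= count_cat /= eqxx.
rewrite -!has_pred1 !has_count !add1n addnS !eqSS addn_eq0.
by case/andP=> /eqP-> /eqP->.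
Qed.

Lemma intersect_arcs a i : a \in cd_word D -> intersect D a i ->
  count_mem i (arcs a).1 = 1%N /\ count_mem i (arcs a).2 = 1%N.
Proof.
move=> aD /andP[ai]; set p := (fun _ => _).
have pa : p a by rewrite /p eqxx.
case/andP: (arcs_notin aD); have := arcsP aD.
move: (arcs a).1 (arcs a).2 => u v.
have : a \notin take (index a D) D by rewrite in_take_leq ?index_size // ltnn.
rewrite rot_index //=.
have : cd_word D = take (index a D) D ++ a :: drop (index a D).+1 D.
  by rewrite -{1}(cat_take_drop (index a D) D) (drop_nth 0%N) ?index_mem // nth_index.
move: (take _ _) (drop _ _) => x r -> ax [e] au av.
have cnt t : count_mem i t = count_mem i (filter p t).
  rewrite count_filter; apply: eq_count => z /=.
  by rewrite /p; case: eqP => // ->; rewrite orbT.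
have fN t : a \notin t -> a \notin filter p t.
  by rewrite mem_filter => /negbTE->; rewrite andbF.
have := congr1 (filter p) e; rewrite !filter_cat /= pa (cnt u) (cnt v).
move: (fN _ ax) (fN _ au) (fN _ av).
move: (filter p x) (filter p u) (filter p v) (filter p r) => X U V Rr aX aU aV E.
have {E} aux : Rr ++ X = [:: i; a; i] -> count_mem i U = 1%N /\ count_mem i V = 1%N.
  rewrite E; case: U aU {E} => [|u0 [|u1 U]] aU /= [].
  - by move=> ea; rewrite ea eqxx in ai.
  - by move=> -> ->; rewrite /= eqxx.
  - by move=> _ e1; rewrite e1 !inE eqxx orbT in aU.
case/orP=> /eqP H; apply: aux.
- case: X H aX => [[->]|x0 X [-> _]] //=; by rewrite inE eqxx.
- case: X H aX => [[ea]|x0 [[-> ->]|x1 X [_ -> _]]] //=.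
  + by rewrite ea eqxx in ai.
  + by rewrite !inE eqxx orbT.
Qed.

Lemma count_merge (i j z : nat) (s : seq nat) : i != j ->
  count_mem z [seq (if x == j then i else x) | x <- s] =
  if z == i then (count_mem i s + count_mem j s)%N
  else if z == j then 0%N else count_mem z s.
Proof.
move=> ij; elim: s => [|x s IH] /=; first by do !case: ifP.
rewrite {}IH; have [->|zi] := eqVneq z i.
  have [->|xj] := eqVneq x j; last by rewrite addnA.
  by rewrite eqxx eq_sym (negbTE ij) addnCA.
have [->|zj] := eqVneq z j.
  by have [_|/negbTE->] := eqVneq x j; rewrite // (negbTE ij).
have [->|//] := eqVneq x j.
by rewrite eq_sym (negbTE zi) eq_sym (negbTE zj).
Qed.

Lemma par_cdE a i j : a \in cd_word D -> intersect D a i -> intersect D a j ->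
  i != j -> cd_word (par_cd a i j) = par_word a i j.
Proof.
move=> aD ai aj ij; rewrite /par_cd insubdK //.
have [iu iv] := intersect_arcs aD ai; have [ju jv] := intersect_arcs aD aj.
apply/allP=> z zw; rewrite count_cat; move: zw; rewrite -has_pred1 has_count count_cat.
rewrite !count_merge // 1?eq_sym // iu iv ju jv.
have [->|zi] := eqVneq z i; first by rewrite (negbTE ij).
have [//|zj] := eqVneq z j.
rewrite -count_cat -has_count has_pred1 count_cat => zw.
case/andP: (arcs_notin aD) => au av.
have za : z != a by apply: contraTneq zw => ->; rewrite mem_cat negb_or au.
rewrite arcs_count // -(mem_rot (index a D)) arcsP //.
by rewrite inE mem_cat inE (negbTE za) /= -mem_cat.
Qed.

Lemma cross_cdE a i j : a \in cd_word D -> intersect D a i -> intersect D a j ->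
  i != j -> cd_word (cross_cd a i j) = cross_word a i j.
Proof.
move=> aD ai aj ij; rewrite /cross_cd insubdK //.
have [iu iv] := intersect_arcs aD ai; have [ju jv] := intersect_arcs aD aj.
set w := cross_word a i j.
pose f x := if x == i then j else if x == j then i else x.
have fK : involutive f.
  move=> x; rewrite /f; have [->|xi] := eqVneq x i.
    by rewrite eq_sym (negbTE ij) eqxx.
  by have [->|xj] := eqVneq x j; rewrite ?eqxx // (negbTE xi) (negbTE xj).
have cf z : count_mem z w = (count_mem z (arcs a).1 + count_mem (f z) (arcs a).2)%N.
  rewrite count_cat count_map; congr addn; apply: eq_count => x /=.
  by rewrite -/(f x) (can2_eq fK fK).
apply/allP=> z; rewrite -has_pred1 has_count cf /f.
have [->|zi] := eqVneq z i; first by rewrite iu jv.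
have [->|zj] := eqVneq z j; first by rewrite ju iv.
rewrite -count_cat -has_count has_pred1 count_cat => zw.
case/andP: (arcs_notin aD) => au av.
have za : z != a by apply: contraTneq zw => ->; rewrite mem_cat negb_or au.
rewrite arcs_count // -(mem_rot (index a D)) arcsP //.
by rewrite inE mem_cat inE (negbTE za) /= -mem_cat.
Qed.

End Surgery.

Definition crossing_chords (D : chord_diagram) (a : nat) : seq nat :=
  [seq x <- chords D | intersect D a x].

(* The characterization of the sl(2)-weight system by its value on the empty
   diagram and the Chmutov-Varchenko relation; the indeterminate 'X of
   {poly R[i]} is the Casimir element c. *)
Definition is_sl2_weight_system (R : realType)
    (w : {linear ASpace R -> {poly R[i]}}) : Prop :=
  w (dvec R empty_cd) = 1 /\
  forall (D : chord_diagram) (a : nat), a \in chords D ->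
    let s := crossing_chords D a in
    let k := size s in
    w (dvec R D) =
      ('X - (k%:R / 2)%:P) * w (dvec R (del_chord D a))
      + 2^-1 *: \sum_(i < k) \sum_(j < k | (i < j)%N)
          (w (dvec R (par_cd D a (nth 0%N s i) (nth 0%N s j)))
           - w (dvec R (cross_cd D a (nth 0%N s i) (nth 0%N s j)))).

(* Main.v *)
Require Import Defs.
From HB Require Import structures.
From mathcomp Require Import all_boot all_order all_algebra.
From mathcomp Require Import perm boolp ring zify.
From mathcomp Require Import generic_quotient reals complex freeg.

(* Write W(D) for the full contraction of the product, read along the circle, of
   the matrices of so(3) = sl(2) in the 3-dimensional representation, each chord
   summing a basis element with itself.  At c = 1 the weight system is W(D) / 3
   up to the normalization (-1/2)^n, because W satisfies the Chmutov-Varchenko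
   relation: if B is the product of the matrices on one arc of the chord a, then
   2 sum_i L_i B L_i = -4 B - sum_i ad(L_i)^2 B, where ad(L_i) acts only on the
   ends of chords crossing a, and the epsilon contraction identity turns the
   action on two such chords into D'' - D^x.

   On the other hand, W(D) is the signed sum of 3^(corank + 1) over all framings:
   both sides obey the same recursion for a pair of crossing chords.  On the
   trace side it comes from sum L M L = M^T - tr M, on the corank side from Schur
   complements with respect to the chords with framing 1, or to the pair with
   framings (0, 0) or (0, 1); interlacement parities of words match the two.

   The 4-term relation holds termwise: adding row and column b to a preserves
   the corank and, when b has framing 1, toggles the framing of a, hence the sign,
   and the edge ab. *)

Set Implicit Arguments.
Unset Strict Implicit.
Unset Printing Implicit Defensive.

Import GRing.Theory Num.Theory.
Local Open Scope ring_scope.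

(** * Iterated sums over colourings of letters *)

Section ColorSums.
Variable T : finType.
Implicit Types (l : seq nat) (s : nat -> T).

Definition upd s x c : nat -> T := fun y => if y == x then c else s y.

Lemma upd_same s x c : upd s x c x = c.
Proof. by rewrite /upd eqxx. Qed.

Lemma upd_other s x c y : y != x -> upd s x c y = s y.
Proof. by rewrite /upd => /negbTE->. Qed.

Lemma upd_upd s x c d : upd (upd s x c) x d = upd s x d.
Proof. by apply/funext => y; rewrite /upd; case: eqP. Qed.

Lemma upd_id s x : upd s x (s x) = s.
Proof. by apply/funext => y; rewrite /upd; case: eqP => [->|]. Qed.

Lemma updC s x c y d : x != y -> upd (upd s x c) y d = upd (upd s y d) x c.
Proof.
move=> xy; apply/funext => z; rewrite /upd.
by have [->|//] := eqVneq z y; rewrite eq_sym (negbTE xy).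
Qed.

(** A colouring is a total function, altered letter by letter from the base [s]. Letters can then be
    split off, reordered and recoloured without changing the type of the summand. *)
Fixpoint csum (V : nmodType) l (Phi : (nat -> T) -> V) s : V :=
  if l is x :: l' then \sum_c csum l' Phi (upd s x c) else Phi s.

Section Values.
Variable V : nmodType.
Implicit Types Phi Psi : (nat -> T) -> V.

Lemma csum_cons x l Phi s : csum (x :: l) Phi s = \sum_c csum l Phi (upd s x c).
Proof. by []. Qed.

Lemma csum_cat l1 l2 Phi : csum (l1 ++ l2) Phi = csum l1 (csum l2 Phi).
Proof.
by apply/funext; elim: l1 => //= x l1 IH s; apply: eq_bigr => c _; apply: IH.
Qed.

Lemma csum_sum (I : Type) (r : seq I) (P : pred I) (Phi : I -> (nat -> T) -> V) l s :
  csum l (fun t => \sum_(i <- r | P i) Phi i t) s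
  = \sum_(i <- r | P i) csum l (Phi i) s.
Proof.
elim: l s => //= x l IH s; rewrite exchange_big.
by apply: eq_bigr => c _; apply: IH.
Qed.

(** Both sums run in parallel with equal colours on [l]. This compares sums whose bases differ, as
    happens once a letter outside [l] has been given a fixed colour. *)
Lemma csum_rel l Phi Psi s s' :
  (forall t t', (forall y, y \notin l -> t y = s y /\ t' y = s' y) ->
    {in l, t =1 t'} -> Phi t = Psi t') ->
  csum l Phi s = csum l Psi s'.
Proof.
elim: l s s' => [|x l IH] s s' H /=; first by apply: H.
apply: eq_bigr => c _; apply: IH => t t' off on; apply: H => y.
  rewrite inE negb_or => /andP[yx yl].
  by case: (off y yl) => -> ->; rewrite !upd_other.
rewrite inE; have [yl _|yl] := boolP (y \in l); first exact: on.
by case: (off y yl) => -> ->; rewrite orbF => /eqP->; rewrite !upd_same.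
Qed.

Lemma csum_eq l Phi Psi s :
  (forall t, (forall y, y \notin l -> t y = s y) -> Phi t = Psi t) ->
  csum l Phi s = csum l Psi s.
Proof.
move=> H; apply: csum_rel => t t' off on.
have -> : t' = t.
  apply/funext => y; have [yl|yl] := boolP (y \in l); first by rewrite on.
  by case: (off y yl) => -> ->.
by apply: H => y /off[].
Qed.

Lemma csum0 l Phi s : (forall t, Phi t = 0) -> csum l Phi s = 0.
Proof. by move=> P0; elim: l s => //= x l IH s; rewrite big1. Qed.

Lemma csum_commute l1 l2 Phi s :
  csum l1 (csum l2 Phi) s = csum l2 (csum l1 Phi) s.
Proof.
have H x l Psi t : \sum_c csum l Psi (upd t x c)
             = csum l (fun t' => \sum_c Psi (upd t' x c)) t.
  elim: l t => //= y l IH t.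
  under [RHS]eq_bigr => d _ do rewrite -IH.
  have [->//|xy] := eqVneq x y.
  rewrite exchange_big; apply: eq_bigr => d _; apply: eq_bigr => c _.
  by rewrite updC.
elim: l1 s => //= x l1 IH s.
by rewrite -H; apply: eq_bigr => c _; apply: IH.
Qed.

Lemma csum_perm l1 l2 Phi s :
  perm_eq l1 l2 -> csum l1 Phi s = csum l2 Phi s.
Proof.
apply: (catCA_perm_subst (F := fun l => csum l Phi s)) => u v w.
by rewrite !csum_cat csum_commute.
Qed.

Lemma csum_rem x l Phi s : x \in l ->
  csum l Phi s = csum (rem x l) (fun t => \sum_c Phi (upd t x c)) s.
Proof.
move=> xl; have /csum_perm-> : perm_eq l (rem x l ++ [:: x]).
  by rewrite perm_sym perm_catC /= perm_sym perm_to_rem.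
by rewrite csum_cat.
Qed.

(* The substitution [g] may recolour several letters at once; [h x] is its effect
   on the colour of [x]. *)
Lemma csum_subst l (g : (nat -> T) -> nat -> T) (h : nat -> T -> T) Phi s :
  (forall x, x \in l -> bijective (h x)) ->
  (forall x c t, x \in l -> g (upd t x c) = upd (g t) x (h x c)) ->
  csum l (Phi \o g) s = csum l Phi (g s).
Proof.
elim: l s => //= x l IH s bh gh.
have [k hK kK] := bh x (mem_head x l).
rewrite [RHS](reindex (h x)); last by exists k => c _.
apply: eq_bigr => c _; rewrite IH ?gh ?mem_head //.
  by move=> y yl; apply: bh; rewrite inE yl orbT.
by move=> y d t yl; apply: gh; rewrite inE yl orbT.
Qed.

End Values.

Lemma csum_morph (V V' : nmodType) (f : {additive V -> V'}) l Phi s :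
  f (csum l Phi s) = csum l (f \o Phi) s.
Proof.
elim: l s => //= x l IH s; rewrite raddf_sum.
by apply: eq_bigr => c _; apply: IH.
Qed.

Lemma csumD (V : nmodType) l (Phi Psi : (nat -> T) -> V) s :
  csum l (fun t => Phi t + Psi t) s = csum l Phi s + csum l Psi s.
Proof.
elim: l s => //= x l IH s; rewrite -big_split.
by apply: eq_bigr => c _; apply: IH.
Qed.

Lemma csumMn (V : nmodType) n l (Phi : (nat -> T) -> V) s :
  csum l (fun t => Phi t *+ n) s = csum l Phi s *+ n.
Proof.
elim: l s => //= x l IH s; rewrite -sumrMnl.
by apply: eq_bigr => c _; apply: IH.
Qed.

Lemma csumN (V : zmodType) l (Phi : (nat -> T) -> V) s :
  csum l (fun t => - Phi t) s = - csum l Phi s.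
Proof.
elim: l s => //= x l IH s; rewrite -sumrN.
by apply: eq_bigr => c _; apply: IH.
Qed.

Lemma csumB (V : zmodType) l (Phi Psi : (nat -> T) -> V) s :
  csum l (fun t => Phi t - Psi t) s = csum l Phi s - csum l Psi s.
Proof. by rewrite csumD csumN. Qed.

Lemma csumZl (F : pzRingType) (k : F) l (Phi : (nat -> T) -> F) s :
  csum l (fun t => k * Phi t) s = k * csum l Phi s.
Proof.
elim: l s => //= x l IH s; rewrite mulr_sumr.
by apply: eq_bigr => c _; apply: IH.
Qed.

Lemma csumZr (F : pzRingType) (k : F) l (Phi : (nat -> T) -> F) s :
  csum l (fun t => Phi t * k) s = csum l Phi s * k.
Proof.
elim: l s => //= x l IH s; rewrite mulr_suml.
by apply: eq_bigr => c _; apply: IH.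
Qed.

End ColorSums.

(** * The matrices of so(3) *)

Section So3.
Variable F : comNzRingType.
Implicit Types (a b c d i j k : 'I_3).

(** The Levi-Civita symbol: 1 on the cyclic shifts of (0, 1, 2) and -1 on the other permutations. *)
Definition eps a b c : F :=
  if [|| a == b, b == c | a == c] then 0
  else if (b : nat) == (a.+1 %% 3)%N then 1 else -1.

Lemma eps_cycle a b c : eps a b c = eps b c a.
Proof.
by case: a => -[|[|[|]]] // ?; case: b => -[|[|[|]]] // ?;
   case: c => -[|[|[|]]] // ?.
Qed.

Lemma eps_anti a b c : eps a b c = - eps b a c.
Proof.
by case: a => -[|[|[|]]] // ?; case: b => -[|[|[|]]] // ?;
   case: c => -[|[|[|]]] // ?; rewrite /eps /= ?oppr0 ?opprK.
Qed.

Lemma eps_contract a b c d :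
  \sum_k eps k a b * eps k c d
  = (a == c)%:R * (b == d)%:R - (a == d)%:R * (b == c)%:R.
Proof.
rewrite !big_ord_recl big_ord0.
by case: a => -[|[|[|]]] // ?; case: b => -[|[|[|]]] // ?;
   case: c => -[|[|[|]]] // ?; case: d => -[|[|[|]]] // ?;
   rewrite /eps /=; ring.
Qed.

(** A basis of so(3) in its adjoint representation, with the sign convention [L_a, L_b] = - sum_c
    eps_abc L_c of [adso3E]. *)
Definition so3 a : 'M[F]_3 := \matrix_(b, c) eps a b c.

Lemma tr_so3 a : (so3 a)^T = - so3 a.
Proof.
by apply/matrixP=> i j; rewrite !mxE eps_cycle eps_anti -eps_cycle.
Qed.

Lemma sum_delta (f : 'I_3 -> F) a : \sum_k (k == a)%:R * f k = f a.
Proof.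
rewrite (bigD1 a) //= eqxx mul1r big1 ?addr0 // => k /negbTE->.
by rewrite mul0r.
Qed.

(** [eps_contract] turns the two ends of a chord into two products of deltas: one transposes the
    enclosed word, the other closes it into a loop of its own. *)
Lemma so3_sandwich (A : 'M[F]_3) :
  \sum_a so3 a * A * so3 a = A^T - (\tr A)%:M.
Proof.
apply/matrixP=> i j; rewrite summxE !mxE.
transitivity (\sum_k \sum_l A k l * \sum_a eps a i k * eps a l j).
  under eq_bigr => a _ do rewrite !mxE.
  rewrite exchange_big [RHS]exchange_big; apply: eq_bigr => l _.
  under [RHS]eq_bigr => k _ do rewrite mulr_sumr.
  rewrite [RHS]exchange_big; apply: eq_bigr => a _.
  rewrite !mxE mulr_suml; apply: eq_bigr => k _; rewrite !mxE.
  by ring.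
rewrite (eq_bigr (fun k => (k == j)%:R * A k i - (i == j)%:R * A k k)); last first.
  move=> k _; under eq_bigr => l _ do rewrite eps_contract mulrBr.
  rewrite sumrB; congr (_ - _).
    transitivity (\sum_l (l == i)%:R * ((k == j)%:R * A k l)).
      by apply: eq_bigr => l _; rewrite (eq_sym i l); ring.
    by rewrite sum_delta.
  transitivity (\sum_l (l == k)%:R * ((i == j)%:R * A k l)).
    by apply: eq_bigr => l _; rewrite (eq_sym k l); ring.
  by rewrite sum_delta.
rewrite sumrB sum_delta -mulr_sumr mulr_natl.
by [].
Qed.

(** A chord joining two loops merges them; the two delta products of [eps_contract] glue them with
    opposite relative orientations. *)
Lemma so3_tr_tr (A B : 'M[F]_3) :
  \sum_a \tr (A * so3 a) * \tr (B * so3 a) = \tr (A * B^T) - \tr (A * B).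
Proof.
transitivity (\sum_i \sum_j \sum_k \sum_l
   A i j * B k l * \sum_a eps a j i * eps a l k).
  rewrite (eq_bigr (fun a => \sum_i \sum_j \sum_k \sum_l
      A i j * B k l * (eps a j i * eps a l k))); last first.
    move=> a _; rewrite mulr_suml; apply: eq_bigr => i _.
    rewrite !mxE mulr_suml; apply: eq_bigr => j _.
    rewrite mulr_sumr; apply: eq_bigr => k _.
    rewrite !mxE mulr_sumr; apply: eq_bigr => l _.
    by rewrite !mxE; ring.
  rewrite exchange_big; apply: eq_bigr => i _.
  rewrite exchange_big; apply: eq_bigr => j _.
  rewrite exchange_big; apply: eq_bigr => k _.
  rewrite exchange_big; apply: eq_bigr => l _.
  by rewrite mulr_sumr.
rewrite /mxtrace -sumrB; apply: eq_bigr => i _.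
rewrite !mxE -sumrB; apply: eq_bigr => j _.
rewrite (eq_bigr (fun k => (k == i)%:R * (A i j * B k j)
                          - (k == j)%:R * (A i j * B k i))).
  by rewrite sumrB !sum_delta mxE.
move=> k _; under eq_bigr => l _ do rewrite eps_contract mulrBr.
rewrite sumrB; congr (_ - _).
  transitivity (\sum_l (l == j)%:R * ((k == i)%:R * (A i j * B k l))).
    by apply: eq_bigr => l _; rewrite (eq_sym j l) (eq_sym i k); ring.
  by rewrite sum_delta.
transitivity (\sum_l (l == i)%:R * ((k == j)%:R * (A i j * B k l))).
  by apply: eq_bigr => l _; rewrite (eq_sym j k) (eq_sym i l); ring.
by rewrite sum_delta.
Qed.

Lemma so3_casimir : \sum_a so3 a * so3 a = - 2%:R.
Proof.
under eq_bigr => a _ do rewrite -[X in X * _]mulr1.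
rewrite so3_sandwich trmx1 mxtrace1 raddfMn /=.
by rewrite (mulrSr 1%:M 2) opprD addrCA subrr addr0.
Qed.

Definition adso3 a (A : 'M[F]_3) := so3 a * A - A * so3 a.

Lemma adso3E a b : adso3 a (so3 b) = - \sum_c eps a b c *: so3 c.
Proof.
apply/matrixP=> i j; rewrite !mxE summxE.
under [in RHS]eq_bigr => k _ do rewrite !mxE -(eps_cycle k).
have H c d : \sum_k so3 c i k * so3 d k j
    = (d == i)%:R * (c == j)%:R - (i == j)%:R * (c == d)%:R.
  transitivity (- \sum_k eps k c i * eps k d j).
    rewrite -sumrN; apply: eq_bigr => k _.
    by rewrite !mxE -(eps_cycle k c) (eps_anti d); ring.
  by rewrite eps_contract (eq_sym d i); ring.
by rewrite !H eps_contract (eq_sym b a); ring.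
Qed.

Lemma adso3M a A B : adso3 a (A * B) = adso3 a A * B + A * adso3 a B.
Proof. by rewrite /adso3 mulrBl mulrBr !mulrA addrA subrK. Qed.

Lemma adso3_1 a : adso3 a 1 = 0.
Proof. by rewrite /adso3 mulr1 mul1r subrr. Qed.

(** The double commutator expands into the Casimir scalar -2 on either side of [B], minus twice the
    sandwich. *)
Lemma so3_sandwich_ad (B : 'M[F]_3) :
  (\sum_a so3 a * B * so3 a) *+ 2
  = - (B *+ 4) - \sum_a adso3 a (adso3 a B).
Proof.
have -> : \sum_a adso3 a (adso3 a B)
   = (\sum_a so3 a * so3 a) * B + B * (\sum_a so3 a * so3 a)
     - (\sum_a so3 a * B * so3 a) *+ 2.
  rewrite mulr_suml mulr_sumr -big_split -sumrMnl -sumrB.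
  apply: eq_bigr => a _; rewrite /adso3 mulrBr mulrBl !mulrA opprB.
  by rewrite [LHS]addrACA -opprD mulr2n.
rewrite so3_casimir mulNr mulrN mulr_natl mulr_natr -[- _ - B *+ 2]opprD -mulrnDr.
by rewrite opprB opprK addrCA addNr addr0.
Qed.

Section Words.
Definition wmx (s : seq nat) (t : nat -> 'I_3) : 'M[F]_3 :=
  \prod_(x <- s) so3 (t x).

Lemma wmx_nil t : wmx [::] t = 1.
Proof. exact: big_nil. Qed.

Lemma wmx_cons x s t : wmx (x :: s) t = so3 (t x) * wmx s t.
Proof. exact: big_cons. Qed.

Lemma wmx_cat s1 s2 t : wmx (s1 ++ s2) t = wmx s1 t * wmx s2 t.
Proof. exact: big_cat. Qed.

Lemma wmx_map f s t : wmx (map f s) t = wmx s (t \o f).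
Proof. by rewrite /wmx big_map. Qed.

(** The basis matrices are antisymmetric, so transposing a product reverses it and costs one sign
    per letter. *)
Lemma wmx_rev s t : wmx (rev s) t = (-1) ^+ size s *: (wmx s t)^T.
Proof.
elim: s => [|x s IH]; first by rewrite !wmx_nil trmx1 expr0 scale1r.
rewrite rev_cons -cats1 wmx_cat IH !wmx_cons wmx_nil mulr1 /= exprS.
rewrite -scalerA trmx_mul tr_so3 mulmxN -scalerAl scaleN1r scalerN.
by rewrite opprK.
Qed.

Lemma wmx_upd s t x c : x \notin s -> wmx s (upd t x c) = wmx s t.
Proof.
move=> xs; apply: eq_big_seq => y ys; rewrite upd_other //.
by apply: contraNneq xs => <-.
Qed.

End Words.
End So3.

(** * Derivations of words *)

Section Derivation.
Variable F : comNzRingType.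
Implicit Types (a b c : 'I_3) (x y : nat) (t : nat -> 'I_3).
Local Notation wmx := (wmx F).
Local Notation so3 := (so3 F).
Local Notation eps := (eps F).

(* The part of [adso3 a (wmx s t)] coming from the occurrences of [x]. *)
Fixpoint der a x (s : seq nat) t : 'M[F]_3 :=
  if s is z :: s' then
    (if z == x then adso3 a (so3 (t z)) else 0) * wmx s' t
    + so3 (t z) * der a x s' t
  else 0.

Lemma sum_der a (l s : seq nat) t : uniq l -> {subset s <= l} ->
  \sum_(x <- l) der a x s t = adso3 a (wmx s t).
Proof.
move=> ul; elim: s => [|z s IH] sl /=.
  by rewrite wmx_nil adso3_1 big1.
rewrite wmx_cons adso3M -IH => [|x xs]; last by rewrite sl // inE xs orbT.
rewrite big_split -mulr_suml -mulr_sumr (bigD1_seq z) ?sl ?mem_head //=.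
by rewrite eqxx big1 ?addr0 // => x; rewrite eq_sym => /negbTE->.
Qed.

Lemma der_notin a x s t : x \notin s -> der a x s t = 0.
Proof.
elim: s => //= z s IH; rewrite inE negb_or eq_sym => /andP[/negbTE-> /IH->].
by rewrite mul0r mulr0 addr0.
Qed.

Lemma der_cat a x s1 s2 t :
  der a x (s1 ++ s2) t = der a x s1 t * wmx s2 t + wmx s1 t * der a x s2 t.
Proof.
elim: s1 => [|z s IH] /=; first by rewrite wmx_nil mul0r mul1r add0r.
by rewrite IH wmx_cat wmx_cons mulrDr !mulrDl !mulrA addrA.
Qed.

Lemma count_mem_split x (s : seq nat) n : count_mem x s = n.+1 ->
  exists s1 s2, [/\ s = s1 ++ x :: s2, x \notin s1 & count_mem x s2 = n].
Proof.
move=> xs; have xs' : x \in s by rewrite -has_pred1 has_count xs.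
move: xs; rewrite -{1 2}(cat_take_drop (index x s) s).
rewrite (drop_nth 0%N) ?index_mem // nth_index // count_cat /= eqxx.
have xt : x \notin take (index x s) s by rewrite in_take_leq ?index_size // ltnn.
rewrite (count_memPn xt) add0n add1n => -[<-].
by exists (take (index x s) s), (drop (index x s).+1 s).
Qed.

(** The basis element [a] acting on the colour of [x] alone, an infinitesimal rotation of that
    colour. *)
Definition turn a x (Phi : (nat -> 'I_3) -> 'M[F]_3) t : 'M[F]_3 :=
  \sum_c eps a (t x) c *: Phi (upd t x c).

Lemma der_once a x s t : count_mem x s = 1%N ->
  der a x s t = - turn a x (wmx s) t.
Proof.
case/count_mem_split=> s1 [s2 [-> x1 /count_memPn x2]].
rewrite der_cat /= !der_notin // mul0r add0r eqxx mulr0 addr0 adso3E.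
rewrite mulNr mulrN mulr_suml mulr_sumr; congr (- _); apply: eq_bigr => c _.
by rewrite wmx_cat wmx_cons !wmx_upd // upd_same -scalerAl -scalerAr.
Qed.

(** Invariance of the sum over c of L_c tensor L_c. With the two summed colours exchanged in the
    term of one end, the two ends cancel by antisymmetry of [eps]. *)
Lemma der_twice a x s t : count_mem x s = 2%N ->
  \sum_c der a x s (upd t x c) = 0.
Proof.
case/count_mem_split=> s1 [_ [-> x1 /count_mem_split[s2 [s3 [-> x2 /count_memPn x3]]]]].
pose G c d := wmx s1 t * (so3 c * (wmx s2 t * (so3 d * wmx s3 t))).
transitivity (- \sum_c \sum_d (eps a c d *: G d c + eps a c d *: G c d)).
  rewrite -sumrN; apply: eq_bigr => c _.
  rewrite der_cat /= der_cat /= !der_notin // !mul0r !mulr0 !add0r !addr0 eqxx.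
  rewrite !wmx_cat !wmx_cons !wmx_upd // upd_same adso3E.
  rewrite big_split opprD mulrDr; congr (_ + _).
    rewrite mulNr mulrN mulr_suml mulr_sumr; congr (- _).
    by apply: eq_bigr => d _; rewrite -scalerAl -scalerAr.
  rewrite mulNr !mulrN mulr_suml !mulr_sumr; congr (- _).
  by apply: eq_bigr => d _; rewrite -scalerAl -!scalerAr.
under eq_bigr => c _ do rewrite big_split.
rewrite big_split /= [X in _ + X]exchange_big -big_split /= big1 ?oppr0 // => c _.
rewrite /= -big_split big1 //= => d _.
by rewrite -scalerDl (eps_cycle _ a c) (eps_anti _ c) (eps_cycle _ a d) addNr scale0r.
Qed.

End Derivation.

(** * The Chmutov-Varchenko recursion for traces *)

Section ChmutovVarchenko.
Variable F : comNzRingType.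
Implicit Types (a b c : 'I_3) (x y : nat) (t : nat -> 'I_3).
Local Notation wmx := (wmx F).
Local Notation so3 := (so3 F).
Local Notation eps := (eps F).
Local Notation turn := (@turn F).
Local Notation der := (der F).

(** The contraction W. The base colour [ord0] is a dummy: it is never read when all letters of [s]
    lie in [l]. *)
Definition wtrace (l s : seq nat) : F :=
  csum l (fun t => \tr (wmx s t)) (fun=> ord0).

Lemma mxtrace_mulrC (A B : 'M[F]_3) : \tr (A * B) = \tr (B * A).
Proof. exact: mxtrace_mulC. Qed.

(** The Casimir acts on a single colour by the scalar -2. *)
Lemma sum_turn2_diag x (Phi : (nat -> 'I_3) -> 'M[F]_3) t :
  \sum_a turn a x (turn a x Phi) t = - (Phi t *+ 2).
Proof.
transitivity (\sum_d (\sum_c \sum_a eps a (t x) c * eps a c d) *: Phi (upd t x d)).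
  rewrite /turn; under eq_bigr => a _ do under eq_bigr => c _ do rewrite scaler_sumr.
  under [RHS]eq_bigr => d _ do rewrite scaler_suml.
  rewrite exchange_big [RHS]exchange_big; apply: eq_bigr => c _.
  under [RHS]eq_bigr => d _ do rewrite scaler_suml.
  rewrite [RHS]exchange_big; apply: eq_bigr => a _; apply: eq_bigr => d _.
  by rewrite upd_same upd_upd scalerA.
have H d : \sum_c \sum_a eps a (t x) c * eps a c d = - ((d == t x)%:R *+ 2).
  under eq_bigr => c _ do rewrite eps_contract.
  rewrite !big_ord_recl big_ord0; move: (t x).
  by case: d => -[|[|[|]]] // ? [] [|[|[|]]] // ? /=; ring.
under eq_bigr => d _ do rewrite H.
rewrite (bigD1 (t x)) //= eqxx upd_id big1 => [|d /negbTE->].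
  by rewrite addr0 scaleNr -scalerMnl scale1r.
by rewrite mul0rn oppr0 scale0r.
Qed.

(** In [eps_contract] the first delta product equates the two old colours and the two new ones,
    which is D''; the second exchanges the colours of [x] and [y], which is D^x. *)
Lemma sum_turn2 x y (Phi : (nat -> 'I_3) -> 'M[F]_3) t : x != y ->
  \sum_a turn a x (turn a y Phi) t
  = (t x == t y)%:R *: (\sum_c Phi (upd (upd t x c) y c))
    - Phi (upd (upd t x (t y)) y (t x)).
Proof.
move=> xy.
transitivity (\sum_c \sum_d (\sum_a eps a (t x) c * eps a (t y) d)
   *: Phi (upd (upd t x c) y d)).
  rewrite /turn exchange_big; apply: eq_bigr => c _.
  under eq_bigr => a _ do rewrite scaler_sumr.
  rewrite exchange_big; apply: eq_bigr => d _.
  rewrite scaler_suml; apply: eq_bigr => a _.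
  by rewrite upd_other 1?eq_sym // scalerA.
pose G c d := Phi (upd (upd t x c) y d).
rewrite (eq_bigr (fun c => (t x == t y)%:R *: G c c
   - (c == t y)%:R *: \sum_d ((d == t x)%:R *: G c d))); last first.
  move=> c _; under eq_bigr => d _ do rewrite eps_contract scalerBl.
  rewrite sumrB; congr (_ - _).
    rewrite (bigD1 c) //= eqxx mulr1 big1 ?addr0 // => d.
    by rewrite eq_sym => /negbTE->; rewrite mulr0 scale0r.
  rewrite scaler_sumr; apply: eq_bigr => d _; rewrite scalerA mulrC.
  by rewrite [t x == d]eq_sym.
rewrite sumrB -scaler_sumr; congr (_ - _).
rewrite (bigD1 (t y)) //= [X in _ + X]big1 ?addr0 => [|c /negbTE->]; last by rewrite scale0r.
rewrite eqxx scale1r (bigD1 (t x)) //= big1 ?addr0 => [|c /negbTE->]; last first.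
  by rewrite scale0r.
by rewrite eqxx scale1r.
Qed.

Lemma turnN a x (Phi : (nat -> 'I_3) -> 'M[F]_3) t :
  turn a x (fun t' => - Phi t') t = - turn a x Phi t.
Proof. by rewrite -sumrN; apply: eq_bigr => c _; rewrite scalerN. Qed.

Lemma turn_sum a x (I : Type) (r : seq I) (Phi : I -> (nat -> 'I_3) -> 'M[F]_3) t :
  turn a x (fun t' => \sum_(i <- r) Phi i t') t = \sum_(i <- r) turn a x (Phi i) t.
Proof.
rewrite exchange_big; apply: eq_bigr => c _; exact: scaler_sumr.
Qed.

Lemma adso3_turn a x (Phi : (nat -> 'I_3) -> 'M[F]_3) t :
  adso3 a (turn a x Phi t) = turn a x (fun t' => adso3 a (Phi t')) t.
Proof.
rewrite /adso3 mulr_sumr mulr_suml -sumrB; apply: eq_bigr => c _.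
by rewrite -scalerAr -scalerAl scalerBr.
Qed.

Variables (l X Y : seq nat).
Hypotheses (ul : uniq l) (lX : {subset X <= l}) (lY : {subset Y <= l}).
Hypothesis lXY : {in l, forall x, count_mem x X + count_mem x Y = 2}%N.

(** For a chord with arcs [X] and [Y]: [cl] holds the chords crossing it, [nl] those nested in [X],
    and [kl] everything except the nested ones. *)
Let cl := [seq x <- l | count_mem x X == 1%N].
Let nl := [seq x <- l | count_mem x X == 2%N].
Let kl := [seq x <- l | count_mem x X != 2%N].
(* The arc [X] with the chords having both ends on it contracted. *)
Let B := csum nl (wmx X).
Let C := wmx Y.

Let cl_uniq : uniq cl. Proof. exact: filter_uniq. Qed.

Let clP x : x \in cl -> [/\ x \in kl, x \in l, x \notin nl & count_mem x X = 1%N].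
Proof.
by rewrite !mem_filter => /andP[/eqP e ->]; rewrite e.
Qed.

Let notin_nl x : x \in Y -> x \notin nl.
Proof.
move=> xY; rewrite mem_filter lY // andbT; apply/eqP => e.
have := lXY (lY xY); rewrite e => /(@addnI 2 _ 0)/eqP.
by apply/negP; rewrite -lt0n -has_count has_pred1.
Qed.

Let turn_B a x t : x \in cl -> csum nl (turn a x (wmx X)) t = turn a x B t.
Proof.
case/clP=> _ _ xnl _.
rewrite (csum_eq (Psi := fun t' => \sum_c eps a (t x) c *: wmx X (upd t' x c))).
  rewrite csum_sum; apply: eq_bigr => c _.
  rewrite -(csum_morph (GRing.scale (eps a (t x) c))) /=; congr (_ *: _).
  apply: (csum_subst _ (g := fun t' => upd t' x c) (h := fun=> id)) => y.
    by exists id.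
  by move=> d t' ynl; rewrite updC //; apply: contraNneq xnl => <-.
by move=> t' tt'; apply: eq_bigr => c _; rewrite tt'.
Qed.

(* The two ends of a chord with both ends on [X] cancel by invariance. *)
Lemma adso3_B a t : adso3 a (B t) = - \sum_(x <- cl) turn a x B t.
Proof.
transitivity (csum nl (fun t' => \sum_(x <- l) der a x X t') t).
  rewrite /adso3 /B -csumZl -csumZr -csumB; apply: csum_eq => t' _.
  by rewrite sum_der.
rewrite csum_sum /cl big_filter -sumrN [RHS]big_mkcond /=.
apply: eq_big_seq => x xl; case: ifP => [c1|c1].
  have xcl : x \in cl by rewrite mem_filter c1.
  rewrite -turn_B // -csumN; apply: csum_eq => t' _.
  by apply: der_once; apply/eqP.
have [c2|c2] := eqVneq (count_mem x X) 2%N.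
  have xnl : x \in nl by rewrite mem_filter c2.
  by rewrite (csum_rem _ _ xnl) csum0 // => t'; apply: der_twice.
apply: csum0 => t'; apply: der_notin; apply/count_memPn.
by move: (lXY xl) c1 c2; case: (count_mem x X) => [|[|[|]]].
Qed.

Lemma adso3_adso3_B a t :
  adso3 a (adso3 a (B t)) = \sum_(x <- cl) \sum_(y <- cl) turn a x (turn a y B) t.
Proof.
rewrite adso3_B {1}/adso3 mulrN mulNr -opprD mulr_sumr mulr_suml -sumrB -sumrN.
apply: eq_bigr => x _; rewrite -[_ - _]/(adso3 a _) adso3_turn.
rewrite -turn_sum -turnN; apply: eq_bigr => c _.
by rewrite adso3_B opprK.
Qed.

(** The chords nested in [X] are neither read by [D] nor disturbed by [g], so their colours can be
    summed first, which replaces the word [X] by [B]. *)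
Lemma wtrace_inner g D :
  (forall x c t, x \in nl -> g (upd t x c) = upd (g t) x c) ->
  (forall t t', (forall y, y \notin nl -> t y = t' y) -> D t = D t') ->
  forall t, csum l (fun t => \tr (wmx X (g t) * D t)) t
  = csum kl (fun t => \tr (B (g t) * D t)) t.
Proof.
move=> gP DP t.
have /csum_perm-> : perm_eq l (kl ++ nl).
  by rewrite perm_sym perm_catC; apply/permEl/perm_filterC.
rewrite csum_cat; apply: csum_eq => t' _.
rewrite (csum_eq (Psi := fun t'' => \tr (wmx X (g t'') * D t'))).
  rewrite -(csum_morph (@mxtrace F 3)) csumZr; congr (\tr (_ * _)).
  rewrite /B -(csum_subst (g := g) (h := fun=> id)) // => x.
  by exists id.
by move=> t'' tt; rewrite (DP t'' t').
Qed.

Let wtrace_XY : wtrace l (X ++ Y) = csum kl (fun t => \tr (B t * C t)) (fun=> ord0).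
Proof.
rewrite -(wtrace_inner (g := id)) //.
  by apply: csum_eq => t _; rewrite wmx_cat.
by move=> t t' tt; apply: eq_big_seq => y yY; rewrite tt ?notin_nl.
Qed.

Definition par_seq x y :=
  [seq if z == y then x else z | z <- X] ++ [seq if z == x then y else z | z <- Y].

Definition cross_seq x y :=
  X ++ [seq if z == x then y else if z == y then x else z | z <- Y].

Let wtrace_par x y : x \in cl -> y \in cl -> x != y ->
  wtrace l (par_seq x y)
  = csum kl (fun t => (t x == t y)%:R *
      \sum_c \tr (B (upd (upd t x c) y c) * C t)) (fun=> ord0).
Proof.
move=> xcl ycl xy; have [xk xl xn _] := clP xcl; have [yk yl yn _] := clP ycl.
(* After relabelling, both points on [X] read the colour of [x] and both points on [Y] that of
   [y]. *)
transitivity (csum kl (fun t => \tr (B (upd t y (t x)) * C (upd t x (t y)))) (fun=> ord0)).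
  rewrite -wtrace_inner.
  - apply: csum_eq => t _; rewrite wmx_cat !wmx_map.
    congr (\tr (wmx _ _ * wmx _ _)); apply/funext => z /=; rewrite /upd.
      by case: ifP.
    by case: ifP.
  - move=> z c t zn; have xz : x != z by apply: contraNneq xn => ->.
    by rewrite (upd_other _ _ xz) updC //; apply: contraNneq yn => <-.
  - move=> t t' tt; apply: eq_big_seq => z zY; rewrite /upd.
    by case: ifP => _; rewrite tt // notin_nl.
have ykx : y \in rem x kl by rewrite mem_rem_uniq ?filter_uniq // inE yk eq_sym xy.
rewrite (csum_rem _ _ xk) (csum_rem _ _ ykx) [RHS](csum_rem _ _ xk).
rewrite [RHS](csum_rem _ _ ykx); apply: csum_eq => t _.
have yx : y != x by rewrite eq_sym.
transitivity (\sum_d \sum_c \tr (B (upd (upd t y c) x c) * C (upd (upd t y d) x d))).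
  apply: eq_bigr => d _; apply: eq_bigr => c _; congr (\tr (B _ * C _)).
    by rewrite upd_same (updC _ _ _ xy) upd_upd.
  by rewrite upd_upd upd_other 1?eq_sym // upd_same.
(* The factor (t x == t y) leaves only the term in which the two colours read on [Y] agree. *)
apply: eq_bigr => d _; rewrite [RHS](bigD1 d) //= [X in _ + X]big1 => [|c cd].
  rewrite upd_same (upd_other _ _ yx) upd_same eqxx mul1r addr0.
  apply: eq_bigr => c _; congr (\tr (B _ * _)).
  by rewrite upd_upd (updC _ _ _ xy) upd_upd.
by rewrite upd_same (upd_other _ _ yx) upd_same (negbTE cd) mul0r.
Qed.

Let wtrace_cross x y : x \in cl -> y \in cl -> x != y ->
  wtrace l (cross_seq x y)
  = csum kl (fun t => \tr (B (upd (upd t x (t y)) y (t x)) * C t)) (fun=> ord0).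
Proof.
move=> xcl ycl xy; have [xk xl xn _] := clP xcl; have [yk yl yn _] := clP ycl.
transitivity (csum kl (fun t => \tr (B t * C (upd (upd t x (t y)) y (t x)))) (fun=> ord0)).
  rewrite -(wtrace_inner (g := id)) //.
  - apply: csum_eq => t _; rewrite wmx_cat !wmx_map.
    congr (\tr (wmx _ _ * wmx _ _)); apply/funext => z /=; rewrite /upd.
    have [->|_] := eqVneq z x; first by rewrite (negbTE xy).
    by case: ifP.
  - move=> t t' tt; apply: eq_big_seq => z zY; rewrite /upd.
    by case: ifP => _; [|case: ifP => _]; rewrite tt // notin_nl.
have ykx : y \in rem x kl by rewrite mem_rem_uniq ?filter_uniq // inE yk eq_sym xy.
rewrite (csum_rem _ _ xk) (csum_rem _ _ ykx) [RHS](csum_rem _ _ xk).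
rewrite [RHS](csum_rem _ _ ykx); apply: csum_eq => t _.
(* Renaming the two summed colours moves the exchange of [x] and [y] from the arc [Y] to the arc
   [X]. *)
rewrite exchange_big; apply: eq_bigr => c _; apply: eq_bigr => d _.
have yx : y != x by rewrite eq_sym.
have H u v : upd (upd (upd (upd t y u) x v) x u) y v = upd (upd t y v) x u.
  by rewrite upd_upd (updC _ _ _ xy) upd_upd.
by rewrite !upd_same !(upd_other _ _ yx) !upd_same !H.
Qed.

Lemma wtrace_par_sym x y : x \in cl -> y \in cl ->
  wtrace l (par_seq x y) = wtrace l (par_seq y x).
Proof.
move=> xcl ycl; have [->//|xy] := eqVneq x y.
have yx : y != x by rewrite eq_sym.
rewrite !wtrace_par //; apply: csum_eq => t _; rewrite [t y == _]eq_sym.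
by congr (_ * _); apply: eq_bigr => c _; rewrite updC.
Qed.

Lemma wtrace_cross_sym x y : x \in cl -> y \in cl ->
  wtrace l (cross_seq x y) = wtrace l (cross_seq y x).
Proof.
move=> xcl ycl; have [->//|xy] := eqVneq x y.
have yx : y != x by rewrite eq_sym.
by rewrite !wtrace_cross //; apply: csum_eq => t _; rewrite updC.
Qed.

(** [so3_sandwich_ad] applied to [B]. In the double commutator, a chord paired with itself yields
    the [size cl] term by the Casimir scalar, and two distinct crossing chords yield D'' - D^x. *)
Theorem wtrace_chmutov_varchenko (a : nat) : a \notin l ->
  wtrace (a :: l) (a :: X ++ a :: Y) *+ 2
  = - (wtrace l (X ++ Y) *+ 4) + wtrace l (X ++ Y) *+ 2 *+ size cl
    - \sum_(x <- cl) \sum_(y <- cl | y != x)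
        (wtrace l (par_seq x y) - wtrace l (cross_seq x y)).
Proof.
move=> al.
have aX : a \notin X by apply: contra al; apply: lX.
have aY : a \notin Y by apply: contra al; apply: lY.
have -> : wtrace (a :: l) (a :: X ++ a :: Y)
  = csum kl (fun t => \tr ((\sum_c so3 c * B t * so3 c) * C t)) (fun=> ord0).
  (* The sandwich is first put around [C], which leaves [X] free for [wtrace_inner]; cyclicity of
     the trace then moves it around [B]. *)
  transitivity (csum kl (fun t => \tr (B t * (\sum_c so3 c * C t * so3 c))) (fun=> ord0)).
    rewrite -(wtrace_inner (g := id)) //; last first.
      move=> t t' tt; apply: eq_bigr => c _; congr (_ * _ * _).
      by apply: eq_big_seq => y yY; rewrite tt ?notin_nl.
    have /csum_perm pa : perm_eq (a :: l) (l ++ [:: a]) by rewrite -cat1s perm_catC.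
    rewrite /wtrace pa csum_cat; apply: csum_eq => t _ /=.
    rewrite mulr_sumr raddf_sum; apply: eq_bigr => c _ /=.
    rewrite wmx_cons wmx_cat wmx_cons !wmx_upd // upd_same.
    by rewrite [RHS]mxtrace_mulrC !mulrA -[in RHS]mulrA [RHS]mxtrace_mulrC mulrA.
  apply: csum_eq => t _; rewrite mulr_sumr mulr_suml !raddf_sum.
  apply: eq_bigr => c _ /=.
  by rewrite mxtrace_mulrC -mulrA mxtrace_mulrC mulrA.
rewrite -csumMn (csum_eq (Psi := fun t => - (\tr (B t * C t) *+ 4)
  - \sum_(x <- cl) \sum_(y <- cl) \tr ((\sum_a turn a x (turn a y B) t) * C t))); last first.
  move=> t _; rewrite -raddfMn -mulrnAl so3_sandwich_ad.
  under eq_bigr => c _ do rewrite adso3_adso3_B.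
  rewrite mulrBl mulNr mulrnAl raddfB raddfN raddfMn; congr (_ - _).
  rewrite exchange_big mulr_suml raddf_sum; apply: eq_bigr => x _.
  by rewrite exchange_big mulr_suml raddf_sum.
rewrite csumB csumN csumMn -wtrace_XY -addrA; congr (_ + _).
(* The multiple is spread over [cl], one copy to match the diagonal pair of each crossing chord. *)
rewrite -[_ *+ size cl]iter_addr_0 -count_predT -big_const_seq -sumrB csum_sum.
rewrite -sumrN; apply: eq_big_seq => x xcl.
rewrite csum_sum (bigD1_seq x) //= opprD; congr (_ - _).
  rewrite (csum_eq (Psi := fun t => - (\tr (B t * C t) *+ 2))).
    by rewrite csumN csumMn -wtrace_XY opprK.
  by move=> t _; rewrite sum_turn2_diag mulNr mulrnAl raddfN raddfMn.
rewrite big_seq_cond [RHS]big_seq_cond; apply: eq_bigr => y /andP[ycl yx].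
have xy : x != y by rewrite eq_sym.
rewrite wtrace_par // wtrace_cross // -csumB; apply: csum_eq => t _.
rewrite sum_turn2 // mulrBl raddfB -scalerAl /= mxtraceZ mulr_suml raddf_sum.
by [].
Qed.

End ChmutovVarchenko.

(** * Pivoting in traces *)

Section Pivot.
Variable F : comNzRingType.
Local Notation wmx := (wmx F).
Local Notation so3 := (so3 F).
Local Notation wtrace := (wtrace F).

Lemma wtrace_perm l1 l2 s : perm_eq l1 l2 -> wtrace l1 s = wtrace l2 s.
Proof. exact: csum_perm. Qed.

Lemma wtrace_rot l s1 s2 : wtrace l (s1 ++ s2) = wtrace l (s2 ++ s1).
Proof.
by apply: csum_eq => t _; rewrite !wmx_cat mxtrace_mulrC.
Qed.

Lemma wtrace_cons x l s :
  wtrace (x :: l) s = csum l (fun t => \sum_c \tr (wmx s (upd t x c))) (fun=> ord0).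
Proof.
have /wtrace_perm-> : perm_eq (x :: l) (l ++ [:: x]) by rewrite -cat1s perm_catC.
by rewrite /wtrace csum_cat.
Qed.

Lemma trmx_wmx s t : (wmx s t)^T = (-1) ^+ size s *: wmx (rev s) t.
Proof. by rewrite wmx_rev scalerA -expr2 -exprM mulnC exprM sqrrN !expr1n scale1r. Qed.

Lemma wtrace_adjacent a l s1 s2 : a \notin s1 -> a \notin s2 ->
  wtrace (a :: l) (s1 ++ [:: a, a & s2]) = - 2%:R * wtrace l (s1 ++ s2).
Proof.
move=> a1 a2; rewrite wtrace_cons -csumZl; apply: csum_eq => t _.
transitivity (\tr (wmx s1 t * (\sum_c so3 c * so3 c) * wmx s2 t)).
  rewrite mulr_sumr mulr_suml raddf_sum; apply: eq_bigr => c _.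
  by rewrite wmx_cat !wmx_cons !wmx_upd // upd_same !mulrA.
rewrite so3_casimir mulrN mulNr raddfN mulNr wmx_cat; congr (- _).
by rewrite mulr_natr mulrnAl raddfMn mulr_natl.
Qed.

(** Summing over the colour of [a] by [so3_sandwich] either reverses one arc, or cuts the word into
    two loops that [b] joins. Summing over the colour of [b] by [so3_tr_tr] then glues these loops
    in two ways. *)
Lemma wtrace_pivot a b l X1 X2 Y1 Y2 : a != b ->
  a \notin X1 ++ X2 ++ Y1 ++ Y2 -> b \notin X1 ++ X2 ++ Y1 ++ Y2 ->
  wtrace (a :: b :: l) (a :: X1 ++ b :: X2 ++ a :: Y1 ++ b :: Y2)
  = (-1) ^+ size (X1 ++ b :: X2)
      * wtrace (b :: l) (rev (X1 ++ b :: X2) ++ Y1 ++ b :: Y2)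
    + wtrace l (X2 ++ X1 ++ Y2 ++ Y1)
    - (-1) ^+ size (Y2 ++ Y1) * wtrace l (X2 ++ X1 ++ rev (Y2 ++ Y1)).
Proof.
rewrite !mem_cat !negb_or => ab /and4P[aX1 aX2 aY1 aY2] /and4P[bX1 bX2 bY1 bY2].
set X := X1 ++ b :: X2; set Y := Y1 ++ b :: Y2.
have aX : a \notin X by rewrite mem_cat inE !negb_or aX1 ab.
have aY : a \notin Y by rewrite mem_cat inE !negb_or aY1 ab.
have -> : a :: X1 ++ b :: X2 ++ a :: Y1 ++ b :: Y2 = a :: X ++ a :: Y.
  by rewrite /X -catA.
rewrite wtrace_cons.
rewrite (csum_eq (Psi := fun t => (-1) ^+ size X * \tr (wmx (rev X ++ Y) t)
   - \tr (wmx X t) * \tr (wmx Y t))); last first.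
  move=> t _; transitivity (\tr ((\sum_c so3 c * wmx X t * so3 c) * wmx Y t)).
    rewrite mulr_suml raddf_sum; apply: eq_bigr => c _.
    by rewrite wmx_cons wmx_cat wmx_cons !wmx_upd // upd_same !mulrA.
  rewrite so3_sandwich mulrBl raddfB /= trmx_wmx -scalerAl mxtraceZ wmx_cat.
  by rewrite -[_%:M * _]/(_%:M *m _) mul_scalar_mx mxtraceZ.
rewrite csumB csumZl -/(wtrace (b :: l) _) -addrA; congr (_ + _).
have -> : csum (b :: l) (fun t => \tr (wmx X t) * \tr (wmx Y t)) (fun=> ord0)
  = csum l (fun t => (-1) ^+ size (Y2 ++ Y1) * \tr (wmx (X2 ++ X1 ++ rev (Y2 ++ Y1)) t)
       - \tr (wmx (X2 ++ X1 ++ Y2 ++ Y1) t)) (fun=> ord0).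
  have /csum_perm-> : perm_eq (b :: l) (l ++ [:: b]) by rewrite -cat1s perm_catC.
  rewrite csum_cat; apply: csum_eq => t _.
  transitivity (\sum_c \tr (wmx (X2 ++ X1) t * so3 c) * \tr (wmx (Y2 ++ Y1) t * so3 c)).
    apply: eq_bigr => c _ /=; rewrite !wmx_cat !wmx_cons !wmx_upd // upd_same.
    by rewrite !mulrA [X in X * _]mxtrace_mulrC [X in _ * X]mxtrace_mulrC !mulrA.
  rewrite so3_tr_tr trmx_wmx -scalerAr mxtraceZ.
  by rewrite -!wmx_cat -!catA.
by rewrite csumB csumZl opprB.
Qed.

End Pivot.

(** * Corank and Schur complements *)

Lemma corankE n (A : 'M['F_2]_n) : corank A = (n - \rank A)%N.
Proof. exact: mxrank_ker. Qed.

Lemma corank_mul_unit n (P A Q : 'M['F_2]_n) :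
  P \in unitmx -> Q \in unitmx -> corank (P *m A *m Q) = corank A.
Proof.
move=> uP uQ; rewrite !corankE mxrankMfree ?row_free_unit //.
by rewrite eqmxMfull ?row_full_unit.
Qed.

Lemma corank_reindex m n (A : 'M['F_2]_m) (B : 'M['F_2]_n) (f : 'I_m -> 'I_n) :
  m = n -> injective f -> (forall i j, A i j = B (f i) (f j)) ->
  corank A = corank B.
Proof.
move=> emn; case: n / emn B f => B f fi AB.
have -> : A = perm_mx (perm fi) *m B *m (perm_mx (perm fi))^T.
  rewrite tr_perm_mx -row_permE -col_permE; apply/matrixP=> i j.
  by rewrite !mxE AB !permE.
by rewrite corank_mul_unit ?unitmx_tr ?unitmx_perm.
Qed.

(** Block elimination writes the matrix as a block diagonal one between unitriangular factors; the
    invertible block [P] contributes its full size to the rank. *)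
Lemma corank_schur m n (P P' : 'M['F_2]_m) (Q : 'M_(m, n)) (R : 'M_(n, m))
    (S : 'M_n) : P *m P' = 1%:M ->
  corank (block_mx P Q R S) = corank (S - R *m P' *m Q).
Proof.
move=> PP'; have P'P := mulmx1C PP'.
have -> : block_mx P Q R S = block_mx 1%:M 0 (R *m P') 1%:M
   *m block_mx P 0 0 (S - R *m P' *m Q) *m block_mx 1%:M (P' *m Q) 0 1%:M.
  rewrite !mulmx_block !mul1mx !mul0mx !mulmx1 !mulmx0 !addr0 !add0r !mulmxA.
  by rewrite PP' mul1mx -(mulmxA R P' P) P'P mulmx1 addrC subrK.
rewrite corank_mul_unit ?unitmxE ?det_lblock ?det_ublock ?det1 ?mulr1 ?unitr1 //.
rewrite !corankE rank_diag_block_mx.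
have /eqP-> : \rank P == m by rewrite -[_ == m]/(row_free P) row_free_unit; case: (mulmx1_unit PP').
by rewrite subnDl.
Qed.

Lemma corank_diag0 n (S : 'M['F_2]_n) :
  corank (block_mx (0 : 'M_1) 0 0 S) = (corank S).+1.
Proof.
by rewrite !corankE rank_diag_block_mx mxrank0 add0n subSn ?rank_leq_row.
Qed.

Section SeqGraphs.
Implicit Types (l : seq nat) (e g : nat -> nat -> bool).

Definition seq_mx l g : 'M['F_2]_(size l) :=
  \matrix_(i, j) (g (nth 0%N l i) (nth 0%N l j))%:R.

Lemma seq_mx_ext l g g' : {in l &, g =2 g'} -> seq_mx l g = seq_mx l g'.
Proof. by move=> gg'; apply/matrixP=> i j; rewrite !mxE gg' ?mem_nth. Qed.

Lemma corank_seq_perm l1 l2 g : uniq l1 -> perm_eq l1 l2 ->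
  corank (seq_mx l1 g) = corank (seq_mx l2 g).
Proof.
move=> u1 p12; have es := perm_size p12.
have mem2 (i : 'I_(size l1)) : nth 0%N l1 i \in l2.
  by rewrite -(perm_mem p12) mem_nth.
have f_lt (i : 'I_(size l1)) : (index (nth 0%N l1 i) l2 < size l2)%N.
  by rewrite index_mem.
apply: (corank_reindex (f := fun i => Ordinal (f_lt i))) => //.
  move=> i j [] /(congr1 (nth 0%N l2)); rewrite !nth_index // => /eqP.
  by rewrite nth_uniq // => /eqP/val_inj.
by move=> i j; rewrite !mxE /= !nth_index.
Qed.

Let b2F (b c : bool) : (b (+) c)%:R = b%:R + c%:R :> 'F_2.
Proof. by case: b c => [] []; apply/eqP. Qed.

Let b2M (b c : bool) : (b && c)%:R = b%:R * c%:R :> 'F_2.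
Proof. by case: b c => [] []; rewrite ?mulr1 ?mulr0. Qed.

Let F2N (x : 'F_2) : - x = x.
Proof. by case: x => -[|[|]] // i; apply/val_inj. Qed.

Lemma seq_mx_cons a l g : seq_mx (a :: l) g
  = block_mx (\matrix_(_ < 1, _ < 1) (g a a)%:R)
             (\matrix_(_ < 1, j < size l) (g a (nth 0%N l j))%:R)
             (\matrix_(i < size l, _ < 1) (g (nth 0%N l i) a)%:R)
             (seq_mx l g) :> 'M_(1 + size l).
Proof.
apply/matrixP=> i j; rewrite mxE.
have -> : i = unsplit (split i) by rewrite splitK.
have -> : j = unsplit (split j) by rewrite splitK.
case: (split i) (split j) => [i'|i'] [j'|j'] /=;
  rewrite ?block_mxEul ?block_mxEur ?block_mxEdl ?block_mxEdr !mxE ?(ord1 i') ?(ord1 j') //.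
Qed.

Lemma corank_seq_cons a l g : corank (seq_mx (a :: l) g)
  = corank (block_mx (\matrix_(_ < 1, _ < 1) (g a a)%:R)
             (\matrix_(_ < 1, j < size l) (g a (nth 0%N l j))%:R)
             (\matrix_(i < size l, _ < 1) (g (nth 0%N l i) a)%:R)
             (seq_mx l g)).
Proof. exact: (congr1 (@corank (1 + size l)) (seq_mx_cons a l g)). Qed.

Lemma corank_seq_isolated a l g : g a a = false ->
  {in l, forall x, g a x = false /\ g x a = false} ->
  corank (seq_mx (a :: l) g) = (corank (seq_mx l g)).+1.
Proof.
move=> aa H; rewrite corank_seq_cons.
have -> : \matrix_(_ < 1, _ < 1) (g a a)%:R = 0 :> 'M['F_2]_1.
  by apply/matrixP=> i j; rewrite !mxE aa.
have -> : \matrix_(_ < 1, j < size l) (g a (nth 0%N l j))%:R = 0 :> 'M['F_2]_(1, size l).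
  by apply/matrixP=> i j; rewrite !mxE; have [|->] := H (nth 0%N l j); rewrite ?mem_nth.
have -> : \matrix_(i < size l, _ < 1) (g (nth 0%N l i) a)%:R = 0 :> 'M['F_2]_(size l, 1).
  by apply/matrixP=> i j; rewrite !mxE; have [|_ ->] := H (nth 0%N l i); rewrite ?mem_nth.
exact: corank_diag0.
Qed.

(** The Schur complement of a diagonal entry 1; its sign disappears over F_2. *)
Lemma corank_seq_pivot1 a l g : g a a ->
  corank (seq_mx (a :: l) g)
  = corank (seq_mx l (fun x y => g x y (+) (g x a && g a y))).
Proof.
move=> aa; rewrite corank_seq_cons aa (corank_schur (P' := 1%:M)).
  congr corank; apply/matrixP=> i j; rewrite !mxE big_ord1 mulmx1 !mxE.
  by rewrite F2N b2F b2M.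
by rewrite mulmx1; apply/matrixP=> i j; rewrite !mxE !ord1.
Qed.

Lemma corank_seq_pivot2 a b l g : g a a = false -> g a b -> g b a ->
  corank (seq_mx (a :: b :: l) g)
  = corank (seq_mx l (fun x y =>
      g x y (+) (g x a && ((g b b && g a y) (+) g b y)) (+) (g x b && g a y))).
Proof.
move=> aa ab ba.
pose c i := if i == ord0 :> 'I_2 then a else b.
pose P : 'M['F_2]_2 := \matrix_(i, j) (g (c i) (c j))%:R.
(* The inverse over F_2 of the block with rows (0, 1) and (1, [g b b]), namely the one with rows
   ([g b b], 1) and (1, 0). *)
pose P' : 'M['F_2]_2 := \matrix_(i, j)
  (if i == ord0 then if j == ord0 then g b b else true else (j == ord0))%:R.
have /(congr1 (@corank (2 + size l))) : seq_mx (a :: b :: l) g = block_mx P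
    (\matrix_(i < 2, j < size l) (g (c i) (nth 0%N l j))%:R)
    (\matrix_(i < size l, j < 2) (g (nth 0%N l i) (c j))%:R) (seq_mx l g)
    :> 'M_(2 + size l).
  apply/matrixP=> i j; rewrite mxE.
  have -> : i = unsplit (split i) by rewrite splitK.
  have -> : j = unsplit (split j) by rewrite splitK.
  have Hc (k : 'I_2) : nth 0%N (a :: b :: l) k = c k.
    by rewrite /c; case: k => -[|[|]].
  case: (split i) (split j) => [i'|i'] [j'|j'];
    rewrite ?block_mxEul ?block_mxEur ?block_mxEdl ?block_mxEdr !mxE.
  - by rewrite -!Hc.
  - by rewrite -!Hc.
  - by rewrite -!Hc.
  - by [].
rewrite (corank_schur (P' := P')) => [->|].
  congr corank; apply/matrixP=> i j; rewrite !mxE !big_ord_recl big_ord0 /=.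
  rewrite !mxE !big_ord_recl !big_ord0 !mxE /c /= F2N.
  by rewrite !b2F !b2M !b2F !b2M mulr1 mulr0 !addr0; ring.
apply/matrixP=> i j; rewrite !mxE !big_ord_recl !big_ord0 !mxE /c /=.
case: i => -[|[|]] // ?; case: j => -[|[|]] // ?;
  rewrite /= ?aa ?ab ?ba; case: (g b b); apply/eqP => //.
Qed.

End SeqGraphs.

(** * Signed sums over framings *)

Section SignedSum.
Variable F : comNzRingType.
Implicit Types (l : seq nat) (e : nat -> nat -> bool) (h f : nat -> bool).

Definition framed e f x y := if x == y then f x else e x y.

(** Framings are treated as two-colourings of the letters, so that [csum] serves both sides of the
    comparison with traces. *)
Definition fsum l e : F :=
  csum l (fun f => \prod_(x <- l) (-1) ^+ f x * 3 ^+ corank (seq_mx l (framed e f)))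
    (fun=> false).

Lemma framed_ext l e e' f f' : {in l, f =1 f'} ->
  {in l &, forall x y, x != y -> e x y = e' x y} ->
  {in l &, framed e f =2 framed e' f'}.
Proof.
move=> ff ee x y xl yl; rewrite /framed; case: eqVneq => [_|xy].
  exact: ff.
exact: ee.
Qed.

Lemma signed_congr n (p p' : F) (A A' : 'M['F_2]_n) :
  p = p' -> A = A' -> p * 3 ^+ corank A = p' * 3 ^+ corank A'.
Proof. by move=> -> ->. Qed.

Lemma fsum_ext l e e' : {in l &, forall x y, x != y -> e x y = e' x y} ->
  fsum l e = fsum l e'.
Proof.
move=> ee; apply: csum_eq => f _.
by rewrite (seq_mx_ext (framed_ext (f' := f) _ ee)).
Qed.

Lemma fsum_perm l1 l2 e : uniq l1 -> perm_eq l1 l2 -> fsum l1 e = fsum l2 e.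
Proof.
move=> u1 p12; rewrite /fsum (csum_perm _ _ p12); apply: csum_eq => f _.
by rewrite (perm_big _ p12) (corank_seq_perm _ u1 p12).
Qed.

Lemma prod_sign l h : \prod_(x <- l) (-1) ^+ h x = (-1) ^+ count h l :> F.
Proof. by elim: l => [|x l IH]; rewrite ?big_nil //= big_cons IH exprD. Qed.

(** Adding [h] permutes the framings and multiplies every sign by the same constant. This absorbs
    the framings toggled by a Schur complement. *)
Lemma fsum_shift l e h s :
  csum l (fun f => \prod_(x <- l) (-1) ^+ f x
      * 3 ^+ corank (seq_mx l (framed e (fun x => f x (+) h x)))) s
  = (-1) ^+ count h l * fsum l e.
Proof.
pose Phi f : F := \prod_(x <- l) (-1) ^+ f x * 3 ^+ corank (seq_mx l (framed e f)).
pose g f := fun x => f x (+) h x.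
transitivity (csum l (fun f => (-1) ^+ count h l * (Phi \o g) f) s).
  apply: csum_eq => f _; rewrite /= /Phi mulrA; congr (_ * _).
  rewrite -prod_sign -big_split; apply: eq_bigr => x _ /=.
  by rewrite /g; case: (h x); case: (f x); rewrite /= !(expr0, expr1, mul1r, mulr1, mulrNN).
rewrite csumZl; congr (_ * _).
rewrite (csum_subst (h := fun x c => c (+) h x)).
- apply: csum_rel => f f' _ ff; rewrite /Phi; apply: signed_congr.
    by apply: eq_big_seq => x xl; rewrite ff.
  by apply: seq_mx_ext; apply: framed_ext.
- by move=> x _; exists (fun c => c (+) h x) => c; rewrite -addbA addbb addbF.
- by move=> x c f _; apply/funext => y; rewrite /g /upd; case: eqP => [->|].
Qed.

(** Framing 0 raises the corank and gives a factor 3; framing 1 leaves the corank of the rest and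
    gives the sign -1. The total is 2. *)
Lemma fsum_isolated a l e : a \notin l ->
  {in l, forall x, e a x = false /\ e x a = false} ->
  fsum (a :: l) e = 2%:R * fsum l e.
Proof.
move=> al H; rewrite /fsum /= big_bool /=.
have E (c : bool) : csum l (fun f => \prod_(x <- a :: l) (-1) ^+ f x
    * 3 ^+ corank (seq_mx (a :: l) (framed e f))) (upd (fun=> false) a c)
  = (if c then -1 else 3) * fsum l e.
  rewrite -csumZl; apply: csum_rel => f f' off on.
  have fa : f a = c by case: (off a al) => -> _; rewrite upd_same.
  rewrite big_cons fa (eq_big_seq (fun x => (-1) ^+ f' x)) => [|x xl]; last by rewrite on.
  have Ha : {in l, forall x, framed e f a x = false /\ framed e f x a = false}.
    move=> x xl; rewrite /framed; have ax : a != x by apply: contraNneq al => ->.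
    by rewrite [x == a]eq_sym (negbTE ax); apply: H.
  have ee : {in l &, framed e f =2 framed e f'} by apply: framed_ext.
  case: c {off} fa => fa.
    rewrite corank_seq_pivot1; last by rewrite /framed eqxx.
    rewrite expr1 -!mulrA; apply: (congr1 ( *%R (-1))); apply: signed_congr; first by [].
    by apply: seq_mx_ext => x y xl yl; rewrite (Ha x xl).2 addbF ee.
  rewrite corank_seq_isolated //; last by rewrite /framed eqxx.
  by rewrite (seq_mx_ext ee) exprS mul1r mulrCA.
by rewrite !E -mulrDl; congr (_ * _); ring.
Qed.

(** The off-diagonal parts of the Schur complements: for [a] framed 1 (local complementation), then
    for the pair [a], [b] framed (0, 0) (the pivot along an edge) and framed (0, 1). *)
Definition local_compl e a x y := e x y (+) (e x a && e a y).
Definition edge_pivot e a b x y :=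
  e x y (+) (e x a && e b y) (+) (e x b && e a y).
Definition edge_pivot1 e a b x y :=
  edge_pivot e a b x y (+) (e x a && e a y).

(** The framings are split by their values at [a] and [b], and each class is reduced by a Schur
    complement. Where the complement also toggles the framings of the neighbours of [a],
    [fsum_shift] supplies the sign. *)
Lemma fsum_pivot a b l e : uniq [:: a, b & l] ->
  {in [:: a, b & l] &, forall x y, e x y = e y x} -> e a b ->
  fsum (a :: b :: l) e
  = - ((-1) ^+ count (e a) (b :: l) * fsum (b :: l) (local_compl e a))
    + fsum l (edge_pivot e a b)
    - (-1) ^+ count (e a) l * fsum l (edge_pivot1 e a b).
Proof.
pose L := a :: b :: l; move=> uL sym eab.
have [ab al bl] : [/\ a != b, a \notin l & b \notin l].
  by move: uL; rewrite /= inE negb_or => /and3P[/andP[]].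
have [aL bL] : a \in L /\ b \in L by rewrite !inE !eqxx orbT.
have lL x : x \in l -> [/\ x \in L, x != a & x != b].
  move=> xl; rewrite !inE xl !orbT; split=> //.
    by apply: contraNneq al => <-.
  by apply: contraNneq bl => <-.
have fr f x y : x != y -> framed e f x y = e x y by rewrite /framed => /negbTE->.
have fd f x : framed e f x x = f x by rewrite /framed eqxx.
have Fab f : framed e f a b by rewrite fr.
have Fba f : framed e f b a by rewrite fr 1?eq_sym // sym.
rewrite -addrA {1}/fsum csum_cons big_bool; congr (_ + _).
  rewrite -[(-1) ^+ _ * _](fsum_shift _ _ _ (upd (fun=> false) a true)) -csumN.
  apply: csum_eq => f off; rewrite big_cons.
  have fa : f a = true by rewrite off ?upd_same // inE negb_or ab.
  rewrite fa expr1 !mulN1r mulNr; congr (- _).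
  rewrite corank_seq_pivot1; last by rewrite fd.
  apply: signed_congr; first by [].
  apply: seq_mx_ext => x y xl yl.
  have [xL xa] : x \in L /\ x != a.
    by move: xl; rewrite inE => /orP[/eqP->|/lL[]]; rewrite // eq_sym.
  have [yL ya] : y \in L /\ y != a.
    by move: yl; rewrite inE => /orP[/eqP->|/lL[]]; rewrite // eq_sym.
  rewrite (fr _ x a) // (fr _ a y) 1?eq_sym // /framed /local_compl.
  by case: eqP => // <-; rewrite (sym x a) // andbb.
(* With [a] framed 0, the framing 0 of [b] comes first. There each diagonal entry changes by the
   same product twice, so no framing is toggled. *)
rewrite [LHS]csum_cons big_bool [LHS]addrC; congr (_ + _).
  rewrite /fsum; apply: csum_rel => f f' off on.
  have fb : f b = false by case: (off b bl) => -> _; rewrite upd_same.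
  have fa : f a = false.
    by case: (off a al) => -> _; rewrite upd_other ?upd_same.
  rewrite !big_cons fa fb !mul1r.
  rewrite (corank_seq_pivot2 l (etrans (fd f a) fa) (Fab f) (Fba f)).
  apply: signed_congr; first by apply: eq_big_seq => x xl; rewrite on.
  apply: seq_mx_ext => x y xl yl; have [xL xa xb] := lL x xl; have [yL ya yb] := lL y yl.
  rewrite fd fb (fr _ x a) // (fr _ x b) // (fr _ a y) 1?eq_sym // (fr _ b y) 1?eq_sym //=.
  rewrite /framed /edge_pivot; case: eqP => // <-.
  by rewrite on // (sym x a) // (sym x b) // -addbA [e b x && _]andbC addbb addbF.
(* Framing 1 at [b] gives the outer minus sign, and the diagonal of the complement changes by
   [e a x]. *)
rewrite -(fsum_shift _ _ _ (upd (upd (fun=> false) a false) b true)) -csumN.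
apply: csum_eq => f off.
have fb : f b = true by rewrite off ?upd_same.
have fa : f a = false by rewrite off // upd_other ?upd_same.
rewrite !big_cons fa fb expr1 mul1r mulN1r mulNr; congr (- _).
rewrite (corank_seq_pivot2 l (etrans (fd f a) fa) (Fab f) (Fba f)).
apply: signed_congr; first by [].
apply: seq_mx_ext => x y xl yl; have [xL xa xb] := lL x xl; have [yL ya yb] := lL y yl.
rewrite fd fb (fr _ x a) // (fr _ x b) // (fr _ a y) 1?eq_sym // (fr _ b y) 1?eq_sym //=.
rewrite /framed /edge_pivot1 /edge_pivot (sym x a) // (sym x b) //.
case: eqP => [<-|_]; first by case: (f x) (e a x) (e b x) => [] [] [].
by case: (e x y) (e a x) (e b x) (e a y) (e b y) => [] [] [] [] [].
Qed.

End SignedSum.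

(** * Interlacement of words *)

Section Lace.
Implicit Types (l s : seq nat) (x y : nat).

Definition oddc s x := odd (count_mem x s).

(* Parity of the number of pairs of positions p < q carrying x and y.  For two
   chords x and y it is 1 iff they interlace, and it is computable from the parts
   of a concatenation, which makes it easy to follow under surgeries. *)
Fixpoint lace s x y : bool :=
  if s is z :: s' then ((z == x) && oddc s' y) (+) lace s' x y else false.

Lemma oddc_cat s1 s2 x : oddc (s1 ++ s2) x = oddc s1 x (+) oddc s2 x.
Proof. by rewrite /oddc count_cat oddD. Qed.

Lemma oddc_cons z s x : oddc (z :: s) x = (z == x) (+) oddc s x.
Proof. by rewrite /oddc /= oddD; case: (z == x). Qed.

Lemma oddc_rev s x : oddc (rev s) x = oddc s x.
Proof. by rewrite /oddc count_rev. Qed.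

Lemma oddc_notin s x : x \notin s -> oddc s x = false.
Proof. by move=> xs; rewrite /oddc (count_memPn xs). Qed.

Lemma lace_cat s1 s2 x y :
  lace (s1 ++ s2) x y = lace s1 x y (+) lace s2 x y (+) (oddc s1 x && oddc s2 y).
Proof.
elim: s1 => [|z s IH]; first by rewrite addbF.
rewrite /= IH oddc_cat oddc_cons.
by case: (z == x) (oddc s x) (oddc s y) (oddc s2 y) (lace s x y) (lace s2 x y)
  => [] [] [] [] [] [].
Qed.

(** Reversal trades the pairs with x before y for those with y before x; together they number the
    product of the two letter counts. *)
Lemma lace_rev s x y : x != y ->
  lace (rev s) x y = lace s x y (+) (oddc s x && oddc s y).
Proof.
move=> xy; elim: s => //= z s IH.
rewrite rev_cons -cats1 lace_cat IH /= !oddc_cons oddc_rev /=.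
have : (z == x) && (z == y) = false.
  by apply/andP => -[/eqP-> /eqP exy]; rewrite exy eqxx in xy.
by case: (z == x) (z == y) (oddc s x) (oddc s y) (lace s x y) => [] [] [] [] [].
Qed.

Lemma laceC s x y : x != y ->
  lace s y x = lace s x y (+) (oddc s x && oddc s y).
Proof.
move=> xy; elim: s => //= z s ->; rewrite !oddc_cons.
have : (z == x) && (z == y) = false.
  by apply/andP => -[/eqP-> /eqP exy]; rewrite exy eqxx in xy.
by case: (z == x) (z == y) (oddc s x) (oddc s y) (lace s x y) => [] [] [] [] [].
Qed.

Lemma lace_notinl s x y : x \notin s -> lace s x y = false.
Proof.
by elim: s => //= z s IH; rewrite inE negb_or eq_sym => /andP[/negbTE-> /IH->].
Qed.

Lemma lace_notinr s x y : y \notin s -> lace s x y = false.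
Proof.
elim: s => //= z s IH; rewrite inE negb_or => /andP[_ ys].
by rewrite IH // oddc_notin // andbF.
Qed.

(** * Interlacement with a chord cutting a word into two arcs *)

Section Chord.
Variables (a : nat) (X Z : seq nat).
Hypotheses (aX : a \notin X) (aZ : a \notin Z).

(** The letters following the first [a] and those following the second differ exactly by the arc [X]
    and [a] itself, so modulo 2 only the ends on [X] remain. *)
Lemma lace_chordl x : x != a -> lace (a :: X ++ a :: Z) a x = oddc X x.
Proof.
move=> xa; rewrite /= lace_cat oddc_cat oddc_cons eqxx /=.
rewrite eq_sym (negbTE xa) !lace_notinl // (oddc_notin aX) /= !addbF.
by rewrite eqxx -addbA addbb addbF.
Qed.

Lemma lace_chordr x : x != a -> lace (a :: X ++ a :: Z) x a = oddc X x.
Proof.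
move=> xa; rewrite /= lace_cat /= oddc_cons eqxx eq_sym (negbTE xa).
by rewrite !lace_notinr // (oddc_notin aZ) andbT.
Qed.

Lemma lace_chord x y : x != a -> y != a ->
  lace (a :: X ++ a :: Z) x y = lace (X ++ Z) x y.
Proof.
move=> xa ya; rewrite /= !lace_cat /= oddc_cons.
by rewrite eq_sym (negbTE xa) eq_sym (negbTE ya).
Qed.

End Chord.

Definition word_on l s :=
  [&& uniq l, all (mem l) s & all (fun x => count_mem x s == 2) l].

Lemma word_onP l s : reflect
  [/\ uniq l, {subset s <= l} & {in l, forall x, count_mem x s = 2}]
  (word_on l s).
Proof.
apply: (iffP and3P) => -[ul sl c2]; split=> //.
- exact/allP.
- by move=> x xl; apply/eqP/(allP c2).
- exact/allP.
- by apply/allP=> x xl; rewrite c2.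
Qed.

Lemma word_on_perm l l' s s' : perm_eq l l' -> perm_eq s s' ->
  word_on l s = word_on l' s'.
Proof.
move=> ll ss; rewrite /word_on (perm_uniq ll); congr [&& _, _ & _].
  by rewrite (perm_all _ ss); apply: eq_all => x /=; rewrite (perm_mem ll).
by rewrite (perm_all _ ll); apply: eq_all => x /=; rewrite (seq.permP ss).
Qed.

Lemma word_on_oddc l s x : word_on l s -> oddc s x = false.
Proof.
case/word_onP=> _ sl c2; have [xl|xl] := boolP (x \in l).
  by rewrite /oddc c2.
by apply: oddc_notin; apply: contra xl; apply: sl.
Qed.

(** All letter counts are even, so a letter has the same parity on both blocks and the pairs across
    them count alike in either order. *)
Lemma lace_rot l s1 s2 x y : word_on l (s1 ++ s2) ->
  lace (s2 ++ s1) x y = lace (s1 ++ s2) x y.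
Proof.
move=> w; have := word_on_oddc x w; have := word_on_oddc y w.
rewrite !lace_cat !oddc_cat.
by case: (oddc s1 x) (oddc s1 y) (oddc s2 x) (oddc s2 y) (lace s1 x y) (lace s2 x y)
  => [] [] [] [] [] [].
Qed.

(** The length is the sum of the letter counts, and modulo 2 only the odd ones matter. It converts
    the number of neighbours of a chord into the length of an arc. *)
Lemma odd_count_oddc l s : uniq l -> {subset s <= l} ->
  odd (count (oddc s) l) = odd (size s).
Proof.
move=> ul; elim: s => [|z s IH] sl.
  by rewrite (eq_count (a2 := pred0)) ?count_pred0.
rewrite /= -IH => [|x xs]; last by rewrite sl // inE xs orbT.
have zl : z \in l by rewrite sl ?mem_head.
rewrite !(seq.permP (perm_to_rem zl)) /= !oddD oddc_cons eqxx addTb.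
have -> : count (oddc (z :: s)) (rem z l) = count (oddc s) (rem z l).
  apply: eq_in_count => x; rewrite mem_rem_uniq // !inE => /andP[xz _].
  by rewrite oddc_cons eq_sym (negbTE xz).
by case: (oddc s z) (odd (count _ _)) => [] [].
Qed.

(* An innermost interval between two equal letters is empty or contains a letter
   once. *)
Lemma word_on_cases l s : word_on l s -> l != [::] ->
  (exists U b V, s = U ++ [:: b, b & V])
  \/ (exists s1 s2 a b X Y1 Y2, s = s1 ++ s2
      /\ s2 ++ s1 = a :: b :: X ++ a :: Y1 ++ b :: Y2).
Proof.
move=> w l0.
have H n U a X V : (size X < n)%N -> s = U ++ a :: X ++ a :: V ->
  (exists U b V, s = U ++ [:: b, b & V])
  \/ (exists s1 s2 a b X Y1 Y2, s = s1 ++ s2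
      /\ s2 ++ s1 = a :: b :: X ++ a :: Y1 ++ b :: Y2).
  elim: n U a X V => // n IH U a [|b X] V; first by left; exists U, a, V.
  move=> Xn es; have [bX|bX] := boolP (b \in X).
    case/splitPr: bX Xn es => P Q Xn es.
    apply: (IH (rcons U a) b P (Q ++ a :: V)).
      by rewrite -ltnS; apply: leq_trans Xn; rewrite /= size_cat ltnS leq_addr.
    by rewrite es cat_rcons /= -!catA.
  right.
  (* The other [b] lies outside the interval, hence after the second [a] once the word is rotated to
     start at the first one. *)
  have bVU : b \in V ++ U.
    have [_ sl c2] := word_onP _ _ w.
    have bs : b \in s by rewrite es mem_cat !inE eqxx !orbT.
    have := c2 _ (sl _ bs); have as' : a \in s by rewrite es mem_cat inE eqxx orbT.
    have := c2 _ (sl _ as'); rewrite es !count_cat /= !count_cat /= !eqxx.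
    have [->|ab] := eqVneq a b.
      by rewrite (count_memPn bX); lia.
    rewrite (count_memPn bX) -has_pred1 has_count count_cat ?(negbTE ab) => _ /=; lia.
  case/splitPr def: _ / bVU => [Y1 Y2].
  exists U, (a :: (b :: X) ++ a :: V), a, b, X, Y1, Y2; split=> //.
  by rewrite /= -catA /= def.
case: s w H => [|a s] w H.
  by case: l l0 w => // x l _ /and3P[_ _ /andP[]].
have [_ sl c2] := word_onP _ _ w.
have as' : a \in s.
  have := c2 a (sl a (mem_head _ _)); rewrite /= eqxx add1n => -[e].
  by rewrite -has_pred1 has_count e.
case/splitPr: as' w H sl c2 => X V _ H _ _.
exact: (H (size X).+1 [::] a X V).
Qed.

End Lace.

(** * Traces and coranks *)

Section TraceCorank.
Variable F : comNzRingType.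

Lemma word_on_rem l s a s' : word_on l s -> a \in l ->
  (forall x, count_mem x s = (a == x) * 2 + count_mem x s')%N ->
  word_on (rem a l) s' /\ a \notin s'.
Proof.
case/word_onP=> ul sl c2 al cs.
have as' : a \notin s'.
  by apply/count_memPn; have := cs a; rewrite c2 // eqxx mul1n => /(@addnI 2 0)/esym.
split=> //; apply/word_onP; split; first exact: rem_uniq.
  move=> x xs'; rewrite mem_rem_uniq // inE.
  rewrite (contraNneq _ as') => [|<- //]; apply: sl.
  by rewrite -has_pred1 has_count cs addn_gt0 -has_count has_pred1 xs' orbT.
move=> x; rewrite mem_rem_uniq // inE => /andP[xa xl].
by have := cs x; rewrite c2 // eq_sym (negbTE xa).
Qed.

(** Induction on the number of chords. A chord with adjacent ends is an isolated vertex; failing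
    that, some rotation exposes two crossing chords for [wtrace_pivot] and [fsum_pivot]. The factor
    3 is the trace of the empty word. *)
Theorem wtrace_fsum l s : word_on l s ->
  (-1) ^+ size l * wtrace F l s = 3 * fsum F l (lace s).
Proof.
have [n] := ubnP (size l); elim: n l s => // n IH l s ln w.
have [ul sl c2] := word_onP _ _ w.
have [l0|l0] := eqVneq l [::].
  have s0 : s = [::].
    by case: (s) sl => // x t /(_ x (mem_head _ _)); rewrite l0.
  rewrite l0 s0 mul1r /wtrace /= wmx_nil mxtrace1 /fsum /= big_nil mul1r.
  by rewrite corankE expr0 mulr1.
have [[U [b [V es]]]|] := word_on_cases w l0.
  have bs : b \in s by rewrite es mem_cat mem_head orbT.
  have bl := sl _ bs.
  have [w' bUV] : word_on (rem b l) (U ++ V) /\ b \notin U ++ V.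
    apply: (word_on_rem w) => // x; rewrite es !count_cat /=; lia.
  have pl := perm_to_rem bl.
  have bl' : b \notin rem b l by rewrite mem_rem_uniq // inE eqxx.
  have [bU bV] : b \notin U /\ b \notin V by apply/norP; rewrite -mem_cat.
  have sz : size l = (size (rem b l)).+1 by rewrite size_rem // prednK // lt0n size_eq0.
  rewrite (wtrace_perm _ _ pl) (fsum_perm _ _ ul pl).
  rewrite {1}es wtrace_adjacent // fsum_isolated //.
    rewrite sz exprS mulN1r mulNr mulNr mulrN opprK mulrCA.
    rewrite (fsum_ext _ (e' := lace (U ++ V))).
      have IHb : (-1) ^+ size (rem b l) * wtrace F (rem b l) (U ++ V)
          = 3 * fsum F (rem b l) (lace (U ++ V)).
        by apply: IH w'; rewrite -ltnS -sz.
      rewrite IHb mulrCA.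
      by [].
    move=> x y xl yl xy; rewrite es !lace_cat /= !oddc_cons.
    have [bx yb] : b != x /\ b != y.
      by split; [apply: contraTneq xl | apply: contraTneq yl] => <-.
    by rewrite (negbTE bx) (negbTE yb).
  move=> x xl; have bx : b != x by apply: contraTneq xl => <-.
  rewrite es !lace_cat /= !oddc_cons !eqxx (negbTE bx) /= !(lace_notinl _ bU, lace_notinl _ bV).
  by rewrite !(lace_notinr _ bU, lace_notinr _ bV) !(oddc_notin bU, oddc_notin bV) /=
    !addbF addbb andbF.
move=> [s1 [s2 [a [b [X [Y1 [Y2 [es er]]]]]]]].
have ws2 : word_on l (s2 ++ s1).
  by rewrite -(word_on_perm (perm_refl l) (s := s)) // es perm_catC.
rewrite {1}es wtrace_rot (fsum_ext _ (e' := lace (s2 ++ s1))); last first.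
  by move=> x y _ _ _; rewrite es (lace_rot _ _ (l := l)) // -es.
move: ws2; rewrite er => {s w sl c2 s1 s2 es er} w.
have [_ sl c2] := word_onP _ _ w.
set w0 := [:: a, b & _] in w sl c2 *.
have aw : a \in w0 by rewrite mem_head.
have bw : b \in w0 by rewrite !inE eqxx orbT.
have ab : b != a.
  apply/eqP => eba; have := c2 a (sl a aw).
  by rewrite /w0 eba /= !count_cat /= !count_cat /= eqxx; lia.
have [w1 aN] : word_on (rem a l) (rev (b :: X) ++ Y1 ++ b :: Y2)
    /\ a \notin rev (b :: X) ++ Y1 ++ b :: Y2.
  apply: (word_on_rem w) (sl _ aw) _ => x.
  by rewrite /w0 !count_cat count_rev /= !count_cat /= !count_cat /=; lia.
have bl : b \in rem a l by rewrite mem_rem_uniq // inE ab sl.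
set l' := rem b (rem a l).
have w2_ Y : (forall x, count_mem x Y = count_mem x (Y2 ++ Y1)) ->
    word_on l' (X ++ Y) /\ b \notin X ++ Y.
  move=> cY; apply: (word_on_rem w1) bl _ => x.
  by rewrite !count_cat count_rev /= cY !count_cat /=; lia.
have [w2 bN] := w2_ (Y2 ++ Y1) (fun=> erefl).
have [w3 _] := w2_ (rev (Y2 ++ Y1)) (fun=> count_rev _ _).
have pl1 : perm_eq (rem a l) (b :: l') by apply: perm_to_rem.
have pl : perm_eq l [:: a, b & l'].
  by apply: perm_trans (perm_to_rem (sl _ aw)) _; rewrite perm_cons.
have ul' : uniq [:: a, b & l'] by rewrite -(perm_uniq pl).
have ll x : x \in l' -> (x != a) /\ (x != b).
  move: ul'; rewrite /= !inE negb_or => /and3P[/andP[_ al'] bl' _] xl.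
  by split; apply: contraTneq xl => ->.
have aX : a \notin b :: X by move: aN; rewrite mem_cat negb_or mem_rev => /andP[].
have aZ : a \notin Y1 ++ b :: Y2 by move: aN; rewrite mem_cat negb_or => /andP[].
have [aY1 aY2] : a \notin Y1 /\ a \notin Y2.
  by move: aZ; rewrite mem_cat inE !negb_or => /and3P[].
have [bX bY2 bY1] : [/\ b \notin X, b \notin Y2 & b \notin Y1].
  by move: bN; rewrite !mem_cat !negb_or => /and3P[].
have aX' : a \notin X by move: aX; rewrite inE negb_or => /andP[].
(* Moving [a] to the end presents [b] as the leading chord, with arcs X a Y1 and Y2 a, so that the
   same lemmas give its interlacements. *)
have er : [:: b & X ++ a :: Y1 ++ b :: Y2] ++ [:: a]
    = b :: (X ++ a :: Y1) ++ b :: (Y2 ++ [:: a]) by rewrite /= -!catA /= -catA.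
have bXa : b \notin X ++ a :: Y1 by rewrite mem_cat inE !negb_or bX ab.
have bYa : b \notin Y2 ++ [:: a] by rewrite mem_cat inE !negb_or bY2 ab.
have lace_b x y : lace w0 x y = lace (b :: (X ++ a :: Y1) ++ b :: (Y2 ++ [:: a])) x y.
  by rewrite -er (lace_rot (l := l) (s1 := [:: a])).
have laceal x : x != a -> lace w0 a x = oddc (b :: X) x := lace_chordl aX aZ (x := x).
have lacear x : x != a -> lace w0 x a = oddc (b :: X) x := lace_chordr aX aZ (x := x).
have lacebl x : x != a -> x != b -> lace w0 b x = oddc X x (+) oddc Y1 x.
  move=> xa xb; rewrite lace_b lace_chordl // oddc_cat oddc_cons.
  by rewrite eq_sym (negbTE xa).
have lacebr x : x != a -> x != b -> lace w0 x b = oddc X x (+) oddc Y1 x.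
  move=> xa xb; rewrite lace_b lace_chordr // oddc_cat oddc_cons.
  by rewrite eq_sym (negbTE xa).
have oddE x : x != b -> oddc (b :: X) x = oddc X x.
  by move=> xb; rewrite oddc_cons eq_sym (negbTE xb).
have lacexy x y : x != a -> y != a -> lace w0 x y = lace ((b :: X) ++ (Y1 ++ b :: Y2)) x y.
  exact: (lace_chord (b :: X) (Y1 ++ b :: Y2)).
have lacexy2 x y : x \in l' -> y \in l' -> lace w0 x y = lace ((X ++ Y1) ++ Y2) x y.
  move=> /ll[xa xb] /ll[ya yb]; rewrite lacexy //.
  have -> : (b :: X) ++ Y1 ++ b :: Y2 = b :: (X ++ Y1) ++ b :: Y2 by rewrite /= -catA.
  exact: lace_chord.
have odd_w x : x \in l' -> oddc Y2 x = oddc X x (+) oddc Y1 x.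
  move=> _; have := word_on_oddc x w2; rewrite !oddc_cat.
  by case: (oddc X x) (oddc Y1 x) (oddc Y2 x) => [] [] [].
have sym : {in [:: a, b & l'] &, forall x y, lace w0 x y = lace w0 y x}.
  move=> x y _ _; have [->//|xy] := eqVneq x y.
  by rewrite (laceC _ xy) (word_on_oddc x w) addbF.
have eab : lace w0 a b by rewrite laceal // oddc_cons eqxx (oddc_notin bX).
rewrite (perm_size pl) (wtrace_perm _ _ pl) (fsum_perm _ _ _ pl) ?(perm_uniq pl) //.
(* [X1] is empty because [b] immediately follows [a]. *)
rewrite fsum_pivot // [wtrace _ _ w0](wtrace_pivot _ _ (X1 := [::])) 1?eq_sym //; last first.
- by rewrite !mem_cat !negb_or bX bY1 bY2.
- by rewrite !mem_cat !negb_or aX' aY1 aY2.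
have szl : (size l' < n)%N.
  by move: ln; rewrite (perm_size pl) /= ltnS; apply: leq_trans; rewrite ltnS leqnSn.
have w1' : word_on (b :: l') (rev (b :: X) ++ Y1 ++ b :: Y2).
  by rewrite -(word_on_perm pl1 (perm_refl _)).
have [ubl ul2] : uniq (b :: l') /\ uniq l' by move: ul' => /= /and3P[_ -> ->].
have IH1 : - (-1) ^+ size l' * wtrace F (b :: l') (rev (b :: X) ++ Y1 ++ b :: Y2)
    = 3 * fsum F (b :: l') (lace (rev (b :: X) ++ Y1 ++ b :: Y2)).
  rewrite -IH; [by rewrite exprS mulN1r | by move: ln; rewrite (perm_size pl) |].
  exact: w1'.
have IH2 := IH _ _ szl w2.
have IH3 := IH _ _ szl w3.
have xbl x : x \in b :: l' -> x != a.
  by rewrite inE => /orP[/eqP->|/ll[]].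
(* The three graphs produced by the pivot are matched with the interlacements of the three surgered
   words, by parities on [X], [Y1] and [Y2]. *)
rewrite (fsum_ext _ (e := local_compl _ _) (e' := lace (rev (b :: X) ++ Y1 ++ b :: Y2))); last first.
  move=> x y /xbl xa /xbl ya xy; rewrite /local_compl laceal // lacear // lacexy //.
  rewrite !(lace_cat _ (Y1 ++ b :: Y2)) lace_rev // !oddc_rev.
  by case: (oddc _ x) (oddc _ y) (oddc _ y) (lace _ x y) (lace _ x y)
    => [] [] [] [] [].
rewrite (fsum_ext _ (e := edge_pivot _ _ _) (e' := lace (X ++ Y2 ++ Y1))); last first.
  move=> x y xl yl xy; have [xa xb] := ll x xl; have [ya yb] := ll y yl.
  rewrite /edge_pivot laceal // lacear // lacebl // lacebr // lacexy2 // !oddE //.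
  rewrite !lace_cat !oddc_cat !odd_w //.
  by case: (oddc X x) (oddc X y) (oddc Y1 x) (oddc Y1 y) (lace X x y) (lace Y1 x y)
    (lace Y2 x y) => [] [] [] [] [] [] [].
rewrite (fsum_ext _ (e := edge_pivot1 _ _ _) (e' := lace (X ++ rev (Y2 ++ Y1)))); last first.
  move=> x y xl yl xy; have [xa xb] := ll x xl; have [ya yb] := ll y yl.
  rewrite /edge_pivot1 /edge_pivot laceal // lacear // lacebl // lacebr // lacexy2 // !oddE //.
  rewrite !lace_cat lace_rev // !oddc_rev !lace_cat !oddc_cat !odd_w //.
  by case: (oddc X x) (oddc X y) (oddc Y1 x) (oddc Y1 y) (lace X x y) (lace Y1 x y)
    (lace Y2 x y) => [] [] [] [] [] [] [].
(* The signs agree since the number of neighbours of [a] has the parity of the length of an arc,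
   with [b] and without it. *)
rewrite -(signr_odd _ (count _ (b :: l'))) -(signr_odd _ (count _ l')).
have -> : odd (count (lace w0 a) (b :: l')) = odd (size (b :: X)).
  rewrite -(odd_count_oddc (l := b :: l')) //.
    by congr odd; apply: eq_in_count => x /xbl xa; rewrite laceal.
  move=> x xX; rewrite -(perm_mem pl1) mem_rem_uniq // inE.
  rewrite (contraNneq _ aX) => [|<- //]; apply: sl.
  by rewrite /w0 inE -cat_cons mem_cat xX orbT.
have -> : odd (count (lace w0 a) l') = odd (size (Y2 ++ Y1)).
  have [_ sl2 _] := word_onP _ _ w2.
  rewrite -(odd_count_oddc (l := l')) // => [|x xY]; last by rewrite sl2 // mem_cat xY orbT.
  congr odd; apply: eq_in_count => x xl; have [xa xb] := ll x xl.
  rewrite laceal // oddE // oddc_cat odd_w //.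
  by case: (oddc X x) (oddc Y1 x) => [] [].
rewrite !signr_odd /= !exprS !mulN1r opprK.
rewrite [LHS](_ : _ =
  (-1) ^+ size X * (- (-1) ^+ size l' * wtrace F (b :: l') (rev (b :: X) ++ Y1 ++ b :: Y2))
  + (-1) ^+ size l' * wtrace F l' (X ++ Y2 ++ Y1)
  - (-1) ^+ size (Y2 ++ Y1)
      * ((-1) ^+ size l' * wtrace F l' (X ++ rev (Y2 ++ Y1)))); last by ring.
rewrite IH1 IH2 IH3; move: (fsum F (b :: l') _) (fsum F l' (lace (X ++ Y2 ++ Y1))).
by move: (fsum F l' _) => f3 f1 f2; ring.
Qed.

End TraceCorank.

(** * The 4-term relation *)

Section GraphSum.
Variable F : comNzRingType.

Definition framing_sum n (G : sgraph n) : F :=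
  \sum_(V : {set 'I_n}) (-1) ^+ #|V| * 3 ^+ corank (framed_adj G (set_framing V)).

Lemma framing_sum_iso m n (G : sgraph m) (H : sgraph n) (f : 'I_m -> 'I_n) :
  m = n -> injective f -> (forall i j, G i j = H (f i) (f j)) ->
  framing_sum G = framing_sum H.
Proof.
move=> emn; case: n / emn H f => H f fi GH.
rewrite /framing_sum [RHS](reindex_inj (imset_inj fi)); apply: eq_bigr => V _.
have E := corank_reindex (A := framed_adj G (set_framing V))
  (B := framed_adj H (set_framing (f @: V))) (erefl _) fi.
rewrite E; first by rewrite card_imset.
by move=> i j; rewrite !mxE (inj_eq fi) GH /set_framing mem_imset.
Qed.

(** Congruence by the transvection 1 + E_ab, which is its own inverse in characteristic 2. *)
Lemma corank_add_row n (A : 'M['F_2]_n) a b : a != b ->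
  corank (\matrix_(i, j) (A i j + (i == a)%:R * A b j + (j == a)%:R * A i b
                          + (i == a)%:R * (j == a)%:R * A b b)) = corank A.
Proof.
move=> ab; pose P : 'M['F_2]_n := 1%:M + delta_mx a b.
have uP : P \in unitmx.
  suff /mulmx1_unit[] : P *m P = 1%:M by [].
  have D : delta_mx a b *m delta_mx a b = 0 :> 'M['F_2]_n.
    by rewrite mul_delta_mx_cond eq_sym (negbTE ab) mulr0n.
  rewrite mulmxDl mul1mx mulmxDr mulmx1 D addr0 -addrA.
  suff -> : delta_mx a b + delta_mx a b = 0 :> 'M['F_2]_n by rewrite addr0.
  by rewrite -mulr2n -scaler_nat (_ : 2%:R = 0) ?scale0r //; apply/val_inj.
have uPT : P^T \in unitmx by rewrite unitmx_tr.
rewrite -(corank_mul_unit A uP uPT); apply: (congr1 (@corank n)).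
have PE (B : 'M['F_2]_n) i j : (P *m B) i j = B i j + (i == a)%:R * B b j.
  rewrite mulmxDl mul1mx !mxE; congr (_ + _).
  rewrite (bigD1 b) //= big1 ?addr0 => [|k kb]; rewrite mxE.
    by rewrite eqxx andbT.
  by rewrite (negbTE kb) andbF mul0r.
apply/matrixP=> i j; rewrite mxE.
have -> : (P *m A *m P^T) i j = (P *m (P *m A)^T) j i.
  by rewrite -[P *m A *m P^T]trmxK [in LHS]trmx_mul trmxK mxE.
by rewrite PE 2![_^T _ _]mxE !PE; ring.
Qed.

(** The conditions describe [framed_adj G f] after adding row and column [b] to row and column [a];
    at (a, a) the two copies of [G a b] cancel. Conditions on an arbitrary [H] let one lemma cover
    the graphs with and without the edge. *)
Lemma corank_switch n (G H : sgraph n) (f h : 'I_n -> 'F_2) a b : a != b ->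
  h a = f a + f b -> {in predC1 a, h =1 f} ->
  (H a b)%:R = (G a b)%:R + f b :> 'F_2 ->
  (forall y, y != a -> y != b -> H a y = G a y (+) G b y) ->
  (forall x y, x != a -> y != a -> H x y = G x y) ->
  corank (framed_adj H h) = corank (framed_adj G f).
Proof.
move=> ab ha hf Hab Ha Hxy; rewrite -(corank_add_row (framed_adj G f) ab).
have F22 (x : 'F_2) : x + x = 0.
  by case: x => -[|[|]] // i; apply/val_inj.
have b2F (x y : bool) : (x (+) y)%:R = x%:R + y%:R :> 'F_2.
  by case: x y => [] []; apply/val_inj.
apply: (congr1 (@corank n)); apply/matrixP=> i j; rewrite !mxE eqxx.
have ba : b != a by rewrite eq_sym.
have [->|ia] := eqVneq i a; have [->|ja] := eqVneq j a;
  rewrite /= ?mulr1n ?mulr0n ?mul1r ?mul0r ?addr0.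
- rewrite (negbTE ab) (negbTE ba) ha (sgraph_sym G b a).
  by rewrite -[X in _ = X + _]addrA F22 addr0.
- have [->|jb] := eqVneq j b; first by rewrite Hab.
  by rewrite Ha // b2F.
- rewrite (negbTE ia) sgraph_sym (sgraph_sym G i a).
  have [->|ib] := eqVneq i b; first by rewrite Hab.
  by rewrite Ha // b2F (sgraph_sym G i b).
- by rewrite Hxy //; case: eqP => // _; apply: hf; rewrite !inE.
Qed.

Definition toggle n (a : 'I_n) (V : {set 'I_n}) : {set 'I_n} :=
  if a \in V then V :\ a else a |: V.

Lemma in_toggle n (a x : 'I_n) V : (x \in toggle a V) = (x == a) (+) (x \in V).
Proof.
rewrite /toggle; case: ifP => aV; rewrite !inE; case: eqVneq => [->|] //=.
  by rewrite aV.
by rewrite aV.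
Qed.

Lemma toggleK n (a : 'I_n) : involutive (toggle a).
Proof. by move=> V; apply/setP=> x; rewrite !in_toggle addKb. Qed.

Lemma sign_toggle n (a : 'I_n) V : (-1) ^+ #|toggle a V| = - (-1) ^+ #|V| :> F.
Proof.
rewrite /toggle; case: ifP => aV.
  by rewrite [in RHS](cardsD1 a) aV exprS mulN1r opprK.
by rewrite cardsU1 aV exprS mulN1r.
Qed.

Lemma framing_sum_four n (G : sgraph n) a b : G a b ->
  framing_sum G - framing_sum (del_edge G a b)
  = framing_sum (switch G a b) - framing_sum (del_edge (switch G a b) a b).
Proof.
move=> Gab; have ab : a != b by apply: contraTneq Gab => ->; rewrite sgraph_irr.
have ba : b != a by rewrite eq_sym.
pose t (H : sgraph n) V : F := 3 ^+ corank (framed_adj H (set_framing V)).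
have E H1 H2 : framing_sum H1 - framing_sum H2
    = \sum_(V : {set 'I_n} | b \in V) (-1) ^+ #|V| * (t H1 V - t H2 V)
    + \sum_(V : {set 'I_n} | b \notin V) (-1) ^+ #|V| * (t H1 V - t H2 V).
  by rewrite -sumrB (bigID (fun V : {set 'I_n} => b \in V)); congr (_ + _);
     apply: eq_bigr => V _; rewrite mulrBr.
have sab : switch G a b a b.
  by rewrite mxE /switch_rel Gab !eqxx ba (negbTE ba).
have say y : y != a -> y != b -> switch G a b a y = G a y (+) G b y.
  by move=> ya yb; rewrite mxE /switch_rel eqxx ya yb (negbTE ya) /= ?orbF.
have sxy x y : x != a -> y != a -> switch G a b x y = G x y.
  by move=> xa ya; rewrite mxE /switch_rel (negbTE xa) (negbTE ya) /= ?addbF.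
have dab (H : sgraph n) : del_edge H a b a b = false.
  by rewrite mxE /del_edge_rel !eqxx andbF.
have day (H : sgraph n) y : y != a -> y != b -> del_edge H a b a y = H a y.
  by move=> ya yb; rewrite mxE /del_edge_rel (negbTE ya) (negbTE yb) /= ?andbF ?andbT.
have dxy (H : sgraph n) x y : x != a -> y != a -> del_edge H a b x y = H x y.
  by move=> xa ya; rewrite mxE /del_edge_rel (negbTE xa) (negbTE ya) /= ?andbF ?andbT.
have dby (H : sgraph n) y : y != a -> y != b -> del_edge H a b b y = H b y.
  by move=> ya yb; apply: dxy.
rewrite [LHS]E [RHS]E.
apply: (f_equal2 +%R).
  (* For [b] framed 1, toggling [a] pairs [G] with the switched graph without the edge, and [G]
     without the edge with the switched graph. The sign change restores the order of the
     difference. *)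
  rewrite [RHS](reindex_inj (inv_inj (toggleK a))).
  have bt V : (b \in toggle a V) = (b \in V) by rewrite in_toggle (negbTE ba).
  apply: eq_big => [V|V bV]; first by rewrite bt.
  have fa : set_framing (toggle a V) a = set_framing V a + set_framing V b.
    by rewrite /set_framing in_toggle eqxx bV; case: (a \in V); apply/val_inj.
  have fx : {in predC1 a, set_framing (toggle a V) =1 set_framing V}.
    by move=> x; rewrite inE /set_framing in_toggle => /negbTE->.
  have bV1 : set_framing V b = 1 by rewrite /set_framing bV.
  have e1 : t (del_edge (switch G a b) a b) (toggle a V) = t G V.
    apply: (f_equal (GRing.exp 3)); apply: (corank_switch ab fa fx).
    - by rewrite dab Gab bV1; apply/val_inj.
    - by move=> y ya yb; rewrite (day _ _ ya yb) (say _ ya yb).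
    - by move=> x y xa ya; rewrite (dxy _ _ _ xa ya) (sxy _ _ xa ya).
  have e2 : t (switch G a b) (toggle a V) = t (del_edge G a b) V.
    apply: (f_equal (GRing.exp 3)); apply: (corank_switch ab fa fx).
    - by rewrite dab sab bV1; apply/val_inj.
    - by move=> y ya yb; rewrite (say _ ya yb) (day _ _ ya yb) (dby _ _ ya yb).
    - by move=> x y xa ya; rewrite (dxy _ _ _ xa ya) (sxy _ _ xa ya).
  by rewrite e1 e2 sign_toggle mulNr -mulrN opprB.
(* For [b] framed 0 nothing is toggled, and each graph is paired with its own switch. *)
apply: eq_bigr => V bV.
have bV0 : set_framing V b = 0 by rewrite /set_framing (negbTE bV).
have fa : set_framing V a = set_framing V a + set_framing V b by rewrite bV0 addr0.
have fx : {in predC1 a, set_framing V =1 set_framing V} by [].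
have -> : t (switch G a b) V = t G V.
  apply: (f_equal (GRing.exp 3)); apply: (corank_switch ab fa fx) => //.
  by rewrite Gab sab bV0 addr0.
have -> : t (del_edge (switch G a b) a b) V = t (del_edge G a b) V.
  apply: (f_equal (GRing.exp 3)); apply: (corank_switch ab fa fx).
  - by rewrite !dab bV0 addr0.
  - by move=> y ya yb; rewrite !(day _ _ ya yb) (say _ ya yb) (dby _ _ ya yb).
  - by move=> x y xa ya; rewrite !(dxy _ _ _ xa ya) (sxy _ _ xa ya).
by [].
Qed.

End GraphSum.

(** * Intersection graphs *)

Section Intersection.
Variable F : comNzRingType.

(** Outside [l] the index is the size of [l], so the default [s x] of [nth] restores the base
    colour. *)
Lemma csum_tuple (T : finType) (V : nmodType) (l : seq nat)
    (Phi : (nat -> T) -> V) s : uniq l ->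
  csum l Phi s
  = \sum_(t : (size l).-tuple T) Phi (fun x => nth (s x) t (index x l)).
Proof.
elim: l s => [|y l IH] s /=.
  rewrite (big_pred1 [tuple]) => [_|t]; last by rewrite [t]tuple0 /= eqxx.
  by congr Phi; apply/funext.
case/andP=> yl ul.
rewrite (reindex (fun p : T * (size l).-tuple T => [tuple of p.1 :: p.2])) /=; last first.
  exists (fun t : (size l).+1.-tuple T => (thead t, [tuple of behead t])) => [[c t] _|t _] /=.
    by rewrite theadE; congr pair; apply/val_inj.
  by rewrite -tuple_eta.
rewrite -(pair_big xpredT xpredT (fun c (t : (size l).-tuple T) =>
  Phi (fun x => nth (s x) (c :: t) (if y == x then 0 else (index x l).+1)))) /=.
apply: eq_bigr => c _; rewrite IH //; apply: eq_bigr => t _; congr Phi.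
apply/funext => x; rewrite /upd eq_sym; have [<-|//] := eqVneq y x.
by rewrite nth_default // size_tuple leqNgt index_mem.
Qed.

Lemma sum_set_tuple (n : nat) (V : nmodType) (G : {set 'I_n} -> V) :
  \sum_(A : {set 'I_n}) G A = \sum_(t : n.-tuple bool) G [set i | tnth t i].
Proof.
rewrite (reindex (fun t : n.-tuple bool => [set i | tnth t i])) //.
exists (fun A : {set 'I_n} => [tuple (i \in A) | i < n]) => [t _|A _].
  by apply: eq_from_tnth => i; rewrite tnth_mktuple inE.
by apply/setP=> i; rewrite inE tnth_mktuple.
Qed.

Lemma framing_sum_fsum (l : seq nat) (G : sgraph (size l)) e : uniq l ->
  (forall i j : 'I_(size l), i != j -> G i j = e (nth 0%N l i) (nth 0%N l j)) ->
  framing_sum F G = fsum F l e.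
Proof.
move=> ul Ge; rewrite /framing_sum sum_set_tuple /fsum (csum_tuple _ _ ul).
apply: eq_bigr => t _.
pose f x := nth false t (index x l).
have fE (i : 'I_(size l)) : f (nth 0%N l i) = tnth t i.
  by rewrite /f index_uniq // (tnth_nth false).
apply: signed_congr; last first.
  apply/matrixP=> i j; rewrite !mxE /framed nth_uniq //.
  rewrite -[nth _ t _]/(f _) fE /set_framing inE.
  have [->|ij] := eqVneq i j; first by rewrite eqxx.
  by rewrite Ge // (negbTE (ij : (i : nat) != j)).
rewrite (big_nth 0%N) big_mkord (eq_bigr (fun i => (-1) ^+ tnth t i)) => [|i _].
  rewrite -prodr_const big_mkcond; apply: eq_bigr => i _.
  by rewrite inE; case: (tnth t i).
by rewrite -[nth _ t _]/(f _) fE.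
Qed.

Lemma lace_filter (p : pred nat) s x y : p x -> p y ->
  lace (filter p s) x y = lace s x y.
Proof.
move=> px py; elim: s => //= z s <-; case: ifP => pz /=.
  congr ((_ && odd _) (+) _); rewrite count_filter; apply: eq_count => u /=.
  by case: eqP => // ->.
by rewrite (_ : (z == x) = false) //; apply: contraFF pz => /eqP->.
Qed.

(** Only the subword of the four ends of [x] and [y] matters. It is coded by four booleans, two of
    each value, and checked case by case. *)
Lemma intersect_lace (D : chord_diagram) x y : x \in cd_word D -> y \in cd_word D ->
  x != y -> intersect D x y = lace D x y.
Proof.
move=> xD yD xy; have yx : y != x by rewrite eq_sym.
pose p z := (z == x) || (z == y).
have px : p x by rewrite /p eqxx.
have py : p y by rewrite /p eqxx orbT.
rewrite -(lace_filter (p := p)) // /intersect xy /= -/p.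
have cp z : p z -> count_mem z (filter p D) = count_mem z D.
  move=> pz; rewrite count_filter; apply: eq_count => u /=.
  by case: eqP => // ->.
have := cp x px; have := cp y py.
have /eqP-> := allP (cd_wordP D) _ xD; have /eqP-> := allP (cd_wordP D) _ yD.
have [t ->] : exists t : seq bool, filter p D = [seq if b then x else y | b <- t].
  exists [seq z == x | z <- filter p D]; rewrite -map_comp.
  rewrite -[LHS]map_id; apply/eq_in_map => z; rewrite mem_filter /p /=.
  by case: eqVneq => //= _ /andP[/eqP].
rewrite !count_map.
have Ey : preim (fun b : bool => if b then x else y) (pred1 y) =1 negb.
  by case; rewrite /= ?eqxx ?(negbTE xy).
have Ex : preim (fun b : bool => if b then x else y) (pred1 x) =1 id.
  by case; rewrite /= ?eqxx ?(negbTE yx).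
rewrite (eq_count Ey) (eq_count Ex) => cy cx.
have : size t = 4.
  by rewrite -(count_predC id t) cx (_ : count (predC id) t = 2) // -cy; apply: eq_count; case.
case: t cx cy => [|b1 [|b2 [|b3 [|b4 [|]]]]] //= cx cy _.
case: b1 cx cy => cx cy; case: b2 cx cy => cx cy; case: b3 cx cy => cx cy;
  case: b4 cx cy => //= _ _; rewrite !eqseq_cons ?eqxx ?(negbTE xy) ?(negbTE yx) //= ?eqxx;
  by rewrite /oddc /= ?eqxx ?(negbTE xy).
Qed.

Lemma word_on_chords (D : chord_diagram) : word_on (chords D) D.
Proof.
apply/word_onP; split; first exact: undup_uniq.
  by move=> x; rewrite mem_undup.
by move=> x; rewrite mem_undup => xD; apply/eqP/(allP (cd_wordP D)).
Qed.

Lemma framing_sum_intersection (D : chord_diagram) :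
  framing_sum F (intersection_graph D) = fsum F (chords D) (lace D).
Proof.
have uD : uniq (chords D) := undup_uniq _.
apply: (framing_sum_fsum uD) => i j ij.
have memD (k : 'I_(size (chords D))) : nth 0%N (chords D) k \in cd_word D.
  by rewrite -(mem_undup D) mem_nth.
rewrite mxE; apply: intersect_lace => //.
by rewrite (nth_uniq 0%N (ltn_ord i) (ltn_ord j) uD).
Qed.

End Intersection.

(** * The recursion for chord diagrams *)

Lemma sum_offdiag (V : nmodType) (s : seq nat) (H : nat -> nat -> V) : uniq s ->
  {in s &, forall x y, H x y = H y x} ->
  \sum_(x <- s) \sum_(y <- s | y != x) H x y
  = (\sum_(i < size s) \sum_(j < size s | (i < j)%N)
       H (nth 0%N s i) (nth 0%N s j)) *+ 2.
Proof.
move=> us Hs; rewrite (big_nth 0%N) big_mkord.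
pose h (i j : 'I_(size s)) := H (nth 0%N s i) (nth 0%N s j).
transitivity (\sum_(i < size s) (\sum_(j < size s | (i < j)%N) h i j
   + \sum_(j < size s | (j < i)%N) h i j)).
  apply: eq_bigr => i _; rewrite (big_nth 0%N) big_mkord.
  rewrite (bigID (fun j : 'I_(size s) => i < j)%N) /=; congr (_ + _);
    apply: eq_bigl => j; rewrite nth_uniq //; lia.
rewrite big_split mulr2n; congr (_ + _).
rewrite (exchange_big_dep xpredT) //=; apply: eq_bigr => i _.
by apply: eq_bigr => j _; apply: Hs; rewrite mem_nth.
Qed.

Section Surgery.
Variables (D : chord_diagram) (a : nat).
Hypothesis aD : a \in cd_word D.
Let X := (arcs D a).1.
Let Y := (arcs D a).2.
Let l := rem a (chords D).

Let al : a \in chords D. Proof. by rewrite mem_undup. Qed.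

Lemma word_on_rot_chord : word_on (chords D) (a :: X ++ a :: Y).
Proof.
rewrite -(word_on_perm (perm_refl _) (s := D)) ?word_on_chords //.
by rewrite -arcsP // perm_sym perm_rot.
Qed.

Lemma word_on_arcs : word_on l (X ++ Y).
Proof.
case: (word_on_rem word_on_rot_chord al (s' := X ++ Y)) => // x.
by rewrite /= !count_cat /=; lia.
Qed.

(** The count of [x] on [X] is at most 2, so it is odd exactly when one end lies there. *)
Lemma intersect_arcsE x : x \in l -> intersect D a x = (count_mem x X == 1%N).
Proof.
rewrite mem_rem_uniq ?undup_uniq // inE mem_undup => /andP[xa xD].
have ax : a != x by rewrite eq_sym.
have /andP[aX aY] := arcs_notin aD.
have w := word_on_rot_chord.
rewrite intersect_lace // -(cat_take_drop (index a D) D).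
rewrite -(lace_rot (l := chords D)); last first.
  by rewrite cat_take_drop word_on_chords.
rewrite -[_ ++ _]/(rot (index a D) D) arcsP // lace_chordl // /oddc.
have := arcs_count aD xD xa; rewrite -/X -/Y.
by case: (count_mem x X) => [|[|[|n]]].
Qed.

Lemma crossing_chordsE :
  crossing_chords D a = [seq x <- l | count_mem x X == 1%N].
Proof.
rewrite /crossing_chords /l rem_filter ?undup_uniq // -filter_predI.
apply: eq_in_filter => x xD /=; have [->|xa] := eqVneq x a.
  by rewrite intersect_irr andbF.
by rewrite andbT intersect_arcsE // mem_rem_uniq ?undup_uniq // inE xa.
Qed.

(** Deletion and both surgeries only rearrange the letters of the two arcs, so the traces of all
    resulting diagrams may be taken over the same list [l]. *)
Lemma chords_perm (E : chord_diagram) :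
  perm_eq E (X ++ Y) -> perm_eq (chords E) l.
Proof.
move=> EXY; have [ul sl c2] := word_onP _ _ word_on_arcs.
apply: uniq_perm => // [|x]; first exact: undup_uniq.
rewrite mem_undup (perm_mem EXY); apply/idP/idP => [/sl //|xl].
by rewrite -has_pred1 has_count c2.
Qed.

Lemma del_chord_perm : perm_eq (del_chord D a) (X ++ Y).
Proof.
have /andP[aX aY] := arcs_notin aD.
have : perm_eq (cd_word D) (rot (index a D) D) by rewrite perm_sym perm_rot.
move=> /(perm_filter (fun x => x != a)) /perm_trans; apply.
rewrite arcsP //= eqxx filter_cat /= eqxx /=.
by rewrite !(all_filterP _) //; apply/allP => x; apply: contraTneq => ->.
Qed.

Lemma par_cd_perm i j : intersect D a i -> intersect D a j -> i != j ->
  perm_eq (par_cd D a i j) (X ++ Y).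
Proof.
move=> ai aj ij; rewrite par_cdE //.
have [iX iY] := intersect_arcs aD ai; have [jX jY] := intersect_arcs aD aj.
apply/allP => z _ /=; rewrite !count_cat !Defs.count_merge // 1?eq_sym //.
rewrite iX iY jX jY; have [->|_] := eqVneq z i; first by rewrite (negbTE ij) iX iY.
by have [->|_] := eqVneq z j; first by rewrite jX jY.
Qed.

Lemma cross_cd_perm i j : intersect D a i -> intersect D a j -> i != j ->
  perm_eq (cross_cd D a i j) (X ++ Y).
Proof.
move=> ai aj ij; rewrite cross_cdE // perm_cat2l.
have [iX iY] := intersect_arcs aD ai; have [jX jY] := intersect_arcs aD aj.
have ji : j != i by rewrite eq_sym.
pose f x := if x == i then j else if x == j then i else x.
have fK : involutive f.
  move=> x; rewrite /f; have [->|xi] := eqVneq x i; first by rewrite (negbTE ji) eqxx.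
  by have [->|xj] := eqVneq x j; rewrite ?eqxx // (negbTE xi) (negbTE xj).
apply/allP => z _ /=; rewrite count_map.
rewrite (eq_count (a2 := pred1 (f z))) => [|x /=]; last by rewrite -/(f x) (can2_eq fK fK).
rewrite /f; have [->|_] := eqVneq z i; first by rewrite jY iY.
by have [->|_] := eqVneq z j; first by rewrite jY iY.
Qed.

Variable F : comNzRingType.
Local Notation trD E := (wtrace F (chords E) E).

Lemma wtrace_diagram : trD D = wtrace F (a :: l) (a :: X ++ a :: Y).
Proof.
rewrite (wtrace_perm _ _ (perm_to_rem al)) -arcsP // /rot wtrace_rot.
by rewrite cat_take_drop.
Qed.

Lemma wtrace_del_chord : trD (del_chord D a) = wtrace F l (X ++ Y).
Proof.
rewrite (wtrace_perm _ _ (chords_perm del_chord_perm)) /=.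
have /andP[aX aY] := arcs_notin aD.
rewrite -(cat_take_drop (index a D) D) filter_cat wtrace_rot -filter_cat.
rewrite -[drop _ _ ++ _]/(rot (index a D) D) arcsP //= eqxx filter_cat /= eqxx /=.
by rewrite !(all_filterP _) //; apply/allP => x; apply: contraTneq => ->.
Qed.

Lemma wtrace_diagram_recursion (s := crossing_chords D a) :
  trD D *+ 2
  = - (trD (del_chord D a) *+ 4) + trD (del_chord D a) *+ 2 *+ size s
    - (\sum_(i < size s) \sum_(j < size s | (i < j)%N)
        (trD (par_cd D a (nth 0%N s i) (nth 0%N s j))
         - trD (cross_cd D a (nth 0%N s i) (nth 0%N s j)))) *+ 2.
Proof.
have [ul sl c2] := word_onP _ _ word_on_arcs.
have lX : {subset X <= l} by move=> x xX; rewrite sl // mem_cat xX.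
have lY : {subset Y <= l} by move=> x xY; rewrite sl // mem_cat xY orbT.
have lXY : {in l, forall x, count_mem x X + count_mem x Y = 2}%N.
  by move=> x xl; rewrite -count_cat c2.
have nal : a \notin l by rewrite mem_rem_uniq ?undup_uniq // inE eqxx.
have us : uniq s by rewrite filter_uniq ?undup_uniq.
have sP x : x \in s -> intersect D a x by rewrite mem_filter => /andP[].
rewrite wtrace_diagram (wtrace_chmutov_varchenko F ul lX lY lXY nal).
rewrite wtrace_del_chord -crossing_chordsE -/s (sum_offdiag us); last first.
  move=> x y; rewrite /s crossing_chordsE => xs ys.
  by rewrite (wtrace_par_sym _ ul lY lXY xs ys) (wtrace_cross_sym _ ul lY lXY xs ys).
apply: (f_equal (fun u => _ - u *+ 2)).
apply: eq_bigr => i _; apply: eq_bigr => j ij.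
have ai := sP _ (mem_nth 0%N (ltn_ord i)); have aj := sP _ (mem_nth 0%N (ltn_ord j)).
have nij : nth 0%N s i != nth 0%N s j by rewrite nth_uniq // neq_ltn ij.
rewrite (wtrace_perm _ _ (chords_perm (par_cd_perm ai aj nij))).
rewrite (wtrace_perm _ _ (chords_perm (cross_cd_perm ai aj nij))).
by rewrite par_cdE // cross_cdE.
Qed.

End Surgery.

(** * The weight system at c = 1 *)

Section Main.
Variable R : realType.
Local Notation C := R[i].

(** Induction on the number of chords. The trace recursion amounts to T(D) = (k - 2) T(D_a) - S; one
    factor -1/2 per chord turns it into (1 - k/2) T(D_a) + S/2, and the division by 3 normalizes the
    empty diagram. *)
Lemma sl2_at_1 (w : {linear ASpace R -> {poly C}}) : is_sl2_weight_system w ->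
  forall D, (w (dvec R D)).[1] = (- 2^-1) ^+ size (chords D) / 3 * wtrace C (chords D) D.
Proof.
case=> w0 wrec D; have [n] := ubnP (size (chords D)); elim: n D => // n IH D Dn.
have [D0|[a aD]] : cd_word D = [::] \/ exists a, a \in cd_word D.
- by case: (cd_word D) => [|a t]; [left | right; exists a; rewrite mem_head].
- have -> : D = empty_cd by apply/val_inj.
  rewrite w0 hornerC /wtrace /= wmx_nil mxtrace1 expr0 mul1r mulVf //.
  by rewrite pnatr_eq0.
have al : a \in chords D by rewrite mem_undup.
rewrite (wrec D a al) !hornerE.
set s := crossing_chords D a; pose l := rem a (chords D).
have szD : size (chords D) = (size l).+1 by rewrite size_rem // prednK //; case: (chords D) al.
have IHl (E : chord_diagram) : perm_eq E ((arcs D a).1 ++ (arcs D a).2) ->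
    (w (dvec R E)).[1] = (- 2^-1) ^+ size l / 3 * wtrace C (chords E) E.
  move=> /(chords_perm aD)/perm_size szE; rewrite IH; last first.
    by rewrite -ltnS szE; move: Dn; rewrite szD.
  by rewrite szE.
have sP x : x \in s -> intersect D a x by rewrite mem_filter => /andP[].
rewrite (IHl _ (del_chord_perm aD)); set c := _ / 3 in IHl *.
have -> : (\sum_(i < size s) \sum_(j < size s | (i < j)%N)
      (w (dvec R (par_cd D a (nth 0%N s i) (nth 0%N s j)))
       - w (dvec R (cross_cd D a (nth 0%N s i) (nth 0%N s j))))).[1]
    = c * \sum_(i < size s) \sum_(j < size s | (i < j)%N)
      (wtrace C (chords (par_cd D a (nth 0%N s i) (nth 0%N s j))) (par_cd D a (nth 0%N s i) (nth 0%N s j))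
       - wtrace C (chords (cross_cd D a (nth 0%N s i) (nth 0%N s j))) (cross_cd D a (nth 0%N s i) (nth 0%N s j))).
  rewrite horner_sum mulr_sumr; apply: eq_bigr => i _.
  rewrite horner_sum mulr_sumr; apply: eq_bigr => j ij.
  have ai := sP _ (mem_nth 0%N (ltn_ord i)); have aj := sP _ (mem_nth 0%N (ltn_ord j)).
  have nij : nth 0%N s i != nth 0%N s j.
    by rewrite nth_uniq ?filter_uniq ?undup_uniq // neq_ltn ij.
  by rewrite hornerD hornerN (IHl _ (par_cd_perm aD ai aj nij))
    (IHl _ (cross_cd_perm aD ai aj nij)) mulrBr.
have := wtrace_diagram_recursion aD C; rewrite -/s szD exprS /=.
move: (wtrace C (chords D) D) (wtrace C (chords (del_chord D a)) _) => z z1.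
move: (\sum_(i < _) _) => S zE.
have -> : z = z *+ 2 / 2 by rewrite -(mulr_natr z 2) mulfK ?pnatr_eq0.
by rewrite zE /c -(mulr_natr z1 4) -(mulr_natr z1 2) -(mulr_natr S 2) -mulr_natr; field.
Qed.

End Main.

(** * The theorem *)

Section Psi.
Variable R : realType.

(** The value is read off a chosen representative; [framing_sum_iso] makes the choice immaterial in
    [psi_gvec]. *)
Definition psi_class (q : graph_class) : R[i]^o :=
  2^-1 ^+ tag (repr q) * framing_sum R[i] (tagged (repr q)).

Definition psi_fun : GSpace R -> R[i]^o := fglift psi_class.

Fact psi_zmod_morphism : zmod_morphism psi_fun.
Proof. exact: lift_is_additive. Qed.

HB.instance Definition _ := GRing.isZmodMorphism.Build
  (GSpace R) R[i]^o psi_fun psi_zmod_morphism.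

Fact psi_scalable : scalable psi_fun.
Proof.
move=> c u; rewrite -[in RHS](freeg_sumE u) -[c *: u]/(fgscale c u) /fgscale.
rewrite !raddf_sum /=; apply: eq_bigr => x _.
by rewrite /psi_fun !liftU -[LHS]scalerA.
Qed.

HB.instance Definition _ := GRing.isScalable.Build
  R[i] (GSpace R) R[i]^o _ psi_fun psi_scalable.

Definition psi : {linear GSpace R -> R[i]^o} := psi_fun.

Lemma psi_gvec n (G : sgraph n) : psi (gvec R G) = 2^-1 ^+ n * framing_sum R[i] G.
Proof.
rewrite /psi /= /psi_fun liftU scale1r /psi_class.
have : giso (repr (gclass G)) (Tagged sgraph G) by apply/eqmodP; rewrite reprK.
case: (repr _) => m H /gisoP[/= emn [f fi fH]].
by rewrite (framing_sum_iso _ emn fi fH) emn.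
Qed.

End Psi.

Theorem proposition3p5 (R : realType) :
  exists psi : {linear GSpace R -> R[i]^o},
    [/\ forall n (G : sgraph n),
          psi (gvec R G) =
          (2^-1 ^+ n * \sum_(V' : {set 'I_n})
            (-1) ^+ #|V'| * 3 ^+ corank (framed_adj G (set_framing V')) : R[i]),
        four_invariant psi
      & forall w : {linear ASpace R -> {poly R[i]}},
          is_sl2_weight_system w ->
          forall D : chord_diagram,
            psi (gvec R (intersection_graph D)) = (w (dvec R D)).[1] ].
Proof.
exists (psi R); split; first exact: psi_gvec.
  have factor (k u v u' v' : R[i]) : u - v = u' - v' -> k * u - k * v = k * u' - k * v'.
    by rewrite -!mulrBr => ->.
  move=> n G a b Gab.
  rewrite (psi_gvec R G) (psi_gvec R (del_edge G a b)) (psi_gvec R (switch G a b)).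
  rewrite (psi_gvec R (del_edge (switch G a b) a b)).
  exact: factor (framing_sum_four R[i] Gab).
move=> w wP D; rewrite psi_gvec framing_sum_intersection (sl2_at_1 wP).
have := wtrace_fsum R[i] (word_on_chords D).
move: (wtrace _ _ _) (fsum _ _ _) => z f zf.
(* The sign from [wtrace_fsum] combines with the factor 2^-n of [psi] into the (-1/2)^n of
   [sl2_at_1]. *)
have -> : f = (-1) ^+ size (chords D) * z / 3 by rewrite zf mulrC mulKf ?pnatr_eq0.
by rewrite !mulrA -exprMn mulrN1 mulrAC.
Qed.
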